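(* Given $\mathsf{G}_0,\mathsf{G}_1\in\mathcal{M}(\Omega,\mathbb{S}^n_+)$, let $\lambda\in\mathcal{M}(\Omega,\mathbb{R}_+)$ be a reference measure such that $|\mathsf{G}_0|,|\mathsf{G}_1|\ll\lambda$. Then there exists $\mu=(\mathsf{G},0,\mathsf{R})\in\mathcal{CE}([0,1];\mathsf{G}_0,\mathsf{G}_1)$ with finite $\mathcal{J}_{\Lambda,Q}(\mu)$. Moreover, $$\mathrm{WB}^2_\Lambda(\mathsf{G}_0,\mathsf{G}_1)\le\mathrm{WB}^2_{(0,\Lambda_2)}(\mathsf{G}_0,\mathsf{G}_1)\le2\|\Lambda_2^{-1}\|_{\mathrm F}^2\int_\Omega\Big\|\sqrt{G_{1,\lambda}}-\sqrt{G_{0,\lambda}}\Big\|_{\mathrm F}^2\,\mathrm{d}\lambda,$$ where $G_{0,\lambda}$ and $G_{1,\lambda}$ are the densities of $\mathsf{G}_0$ and $\mathsf{G}_1$ with respect to $\lambda$.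
   Context: Matrices: $\mathbb{S}^n,\mathbb{S}^n_+,\mathbb{S}^n_{++}$ are the real symmetric, positive semidefinite, positive definite $n\times n$ matrices; $\mathbb{M}^n=\mathbb{R}^{n\times n}$; $A\cdot B=\mathrm{Tr}(A^{\mathrm T}B)$, $\|A\|_{\mathrm F}=\sqrt{A\cdot A}$; $A^\dagger$ is the pseudoinverse; $\mathrm{Ran}$ is the range; $\sqrt{A}$ is the positive semidefinite square root. $\mathcal{M}(\mathcal{X},V)$ denotes finite $V$-valued Radon measures on a compact metric space $\mathcal{X}$. Weights and action: fix positive integers $n,k,d$ and $\Lambda=(\Lambda_1,\Lambda_2)$ with $\Lambda_1\in\mathbb{S}^k_+$, $\Lambda_2\in\mathbb{S}^n_{++}$. Put $\mathbb{X}=\mathbb{S}^n\times\mathbb{R}^{n\times k}\times\mathbb{M}^n$. Define $J_\Lambda(X,Y,Z)=\frac12(Y\Lambda_1^\dagger)\cdot(X^\dagger Y\Lambda_1^\dagger)+\frac12(Z\Lambda_2^{-1})\cdot(X^\dagger Z\Lambda_2^{-1})$ if $X\in\mathbb{S}^n_+$, $\mathrm{Ran}(Y^{\mathrm T})\subset\mathrm{Ran}(\Lambda_1)$ and $\mathrm{Ran}([Y,Z])\subset\mathrm{Ran}(X)$, and $+\infty$ otherwise. For $\mu=(\mathsf{G},\mathsf{q},\mathsf{R})\in\mathcal{M}(\mathcal{X},\mathbb{X})$, $\mathcal{J}_{\Lambda,\mathcal{X}}(\mu)=\int_{\mathcal{X}}J_\Lambda(\frac{\mathrm{d}\mu}{\mathrm{d}\lambda})\,\mathrm{d}\lambda$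 for any nonnegative finite Radon $\lambda$ with $|\mu|\ll\lambda$ (independent of $\lambda$). Continuity equation: $\Omega\subset\mathbb{R}^d$ is compact with nonempty interior and smooth boundary; $Q=[0,1]\times\Omega$. $\mathsf{D}^*$ is a first-order constant-coefficient linear differential operator from $\mathbb{S}^n$-valued to $\mathbb{R}^{n\times k}$-valued functions on $\mathbb{R}^d$ with $\mathsf{D}^*(I)=0$; i.e. $\mathsf{D}^*\Phi=L_0(\Phi)+\sum_{j=1}^dL_j(\partial_{x_j}\Phi)$ with linear $L_j:\mathbb{S}^n\to\mathbb{R}^{n\times k}$ and $L_0(I)=0$; on functions of $(t,x)$ it acts in $x$. $C^1(Q,\mathbb{S}^n)$: derivatives exist in the interior and extend continuously to the boundary. $\Phi_t=\Phi(t,\cdot)$. $\mathcal{CE}([0,1];\mathsf{G}_0,\mathsf{G}_1)$ is the set of $\mu=(\mathsf{G},\mathsf{q},\mathsf{R})\in\mathcal{M}(Q,\mathbb{X})$ with $$\int_Q\partial_t\Phi\cdot\mathrm{d}\mathsf{G}+\mathsf{D}^*\Phi\cdot\mathrm{d}\mathsf{q}+\Phi\cdot\mathrm{d}\mathsf{R}=\int_\Omega\Phi_1\cdot\mathrm{d}\mathsf{G}_1-\int_\Omega\Phi_0\cdot\mathrm{d}\mathsf{G}_0\quad\forall\Phi\in C^1(Q,\mathbb{S}^n).$$ $\mathrm{WB}^2_\Lambda(\mathsf{G}_0,\mathsf{G}_1)=\inf\{\mathcal{J}_{\Lambda,Q}(\mu):\mu\in\mathcal{CE}([0,1];\mathsf{G}_0,\mathsf{G}_1)\}$;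 $\mathrm{WB}_{(0,\Lambda_2)}$ is the same with $\Lambda_1$ replaced by $0$. *)

(* Defs.v *)
From HB Require Import structures.
From mathcomp Require Import all_boot all_order all_algebra.
From mathcomp Require Import all_classical all_reals all_analysis.

Set Implicit Arguments.
Unset Strict Implicit.
Unset Printing Implicit Defensive.

Import Order.TTheory GRing.Theory Num.Theory.
Import numFieldNormedType.Exports.

Local Open Scope classical_set_scope.
Local Open Scope ring_scope.

Section matrices.
Context {R : realType}.

Definition symmx n (A : 'M[R]_n) : Prop := A^T = A.

Definition psd n (A : 'M[R]_n) : Prop :=
  symmx A /\ forall v : 'rV[R]_n, 0 <= (v *m A *m v^T) 0 0.

Definition posdef n (A : 'M[R]_n) : Prop :=
  symmx A /\ forall v : 'rV[R]_n, v != 0 -> 0 < (v *m A *m v^T) 0 0.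

Definition mxdot m n (A B : 'M[R]_(m, n)) : R := \tr (A^T *m B).

Definition frob m n (A : 'M[R]_(m, n)) : R := Num.sqrt (mxdot A A).

(* [ran A] is the column space; MathComp's (_ <= _)%MS compares row spaces. *)
Definition ran_sub m n p (A : 'M[R]_(m, n)) (B : 'M[R]_(m, p)) : bool :=
  (A^T <= B^T)%MS.

(* Moore-Penrose pseudoinverse, which MathComp's [pinvmx] is not in general. *)
Definition is_mpinv m n (A : 'M[R]_(m, n)) (B : 'M[R]_(n, m)) : Prop :=
  [/\ A *m B *m A = A, B *m A *m B = B, symmx (A *m B) & symmx (B *m A)].

Definition mpinv m n (A : 'M[R]_(m, n)) : 'M[R]_(n, m) :=
  xget 0 [set B | is_mpinv A B].

Definition psd_sqrt n (A : 'M[R]_n) : 'M[R]_n :=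
  xget 0 [set B | psd B /\ B *m B = A].

Lemma is_mpinv_uniq m n (A : 'M[R]_(m, n)) B C :
  is_mpinv A B -> is_mpinv A C -> B = C.
Proof.
move=> [ABA BAB sAB sBA] [ACA CAC sAC sCA].
have ABC : A *m B = A *m C.
  rewrite -[LHS]sAB -[in LHS]ACA -[A *m C *m A *m B]mulmxA trmx_mul sAB sAC.
  by rewrite mulmxA ABA.
have BAC : B *m A = C *m A.
  rewrite -[LHS]sBA -[in LHS]ACA -[A *m C *m A]mulmxA mulmxA trmx_mul sBA sCA.
  by rewrite -mulmxA [A *m (B *m A)]mulmxA ABA.
by rewrite -BAB BAC -mulmxA ABC mulmxA CAC.
Qed.

Lemma mulmx_tr_eq0 m n (A : 'M[R]_(m, n)) : A *m A^T = 0 -> A = 0.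
Proof.
move=> /matrixP AA; apply/matrixP => i j; have := AA i i; rewrite !mxE.
move/eqP; rewrite psumr_eq0 => [/allP/(_ j)|l _]; last first.
  by rewrite mxE -expr2 sqr_ge0.
by rewrite mem_index_enum mxE -expr2 sqrf_eq0 => /(_ isT)/eqP.
Qed.

Lemma row_free_gram m n (A : 'M[R]_(m, n)) : row_free A -> A *m A^T \in unitmx.
Proof.
move=> fA; rewrite -row_free_unit; apply/row_freeP.
suff : row_free (A *m A^T) by move/row_freeP.
apply/inj_row_free => v vAA; apply: (row_free_inj fA); rewrite mul0mx.
by apply: mulmx_tr_eq0; rewrite trmx_mul mulmxA -[v *m A *m _]mulmxA vAA mul0mx.
Qed.

Lemma is_mpinv_ex m n (A : 'M[R]_(m, n)) : exists B, is_mpinv A B.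
Proof.
have [r [C [F [CF fF fC]]]] : exists r, exists C : 'M[R]_(m, r),
    exists F : 'M[R]_(r, n), [/\ A = C *m F, row_free F & row_free C^T].
  exists (\rank A), (col_base A), (row_base A); split.
  - by rewrite mulmx_base.
  - exact: row_base_free.
  - by rewrite /row_free mxrank_tr -/(row_full _) col_base_full.
have uF : F *m F^T \in unitmx by exact: row_free_gram.
have uC : C^T *m C \in unitmx by rewrite -[X in _ *m X]trmxK; exact: row_free_gram.
pose F' := F^T *m invmx (F *m F^T); pose C' := invmx (C^T *m C) *m C^T.
have FF' : F *m F' = 1%:M by rewrite mulmxA mulmxV.
have C'C : C' *m C = 1%:M by rewrite -mulmxA mulVmx.
have AB : A *m (F' *m C') = C *m C'.
  by rewrite CF -mulmxA [F *m _]mulmxA FF' mul1mx.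
have BA : F' *m C' *m A = F' *m F.
  by rewrite CF -mulmxA [C' *m _]mulmxA C'C mul1mx.
exists (F' *m C'); split; rewrite /symmx ?AB ?BA.
- by rewrite CF -mulmxA [C' *m _]mulmxA C'C mul1mx.
- by rewrite -mulmxA [F *m _]mulmxA FF' mul1mx.
- by rewrite /C' !trmx_mul trmx_inv trmx_mul !trmxK mulmxA.
- by rewrite /F' !trmx_mul trmx_inv trmx_mul !trmxK mulmxA.
Qed.

Lemma mpinvP m n (A : 'M[R]_(m, n)) : is_mpinv A (mpinv A).
Proof. by have [B AB] := is_mpinv_ex A; apply: (xgetPex 0); exists B. Qed.

End matrices.

(* The product sigma-algebra on [R * 'rV[R]_d] is then its Borel sigma-algebra,
   both factors being second countable. *)
HB.instance Definition _ (R : realType) (m n : nat) :=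
  @isMeasurable.Build default_measure_display 'M[R]_(m, n)
    <<s @open 'M[R]_(m, n) >> (@sigma_algebra0 _ setT _)
    (@sigma_algebraC 'M[R]_(m, n) _) (@sigma_algebra_bigcup _ setT _).

(* Every finite Borel measure on a compact metric space is Radon; a finite
   signed measure is a charge, and a matrix-valued one a matrix of charges.
   A measure on a compact set [K] is a measure on the ambient space that
   vanishes outside [K]. *)

Section charges.
Context {R : realType} {d : measure_display} {T : measurableType d}.

Lemma hahn_exists (nu : {charge set T -> \bar R}) :
  exists PN : set T * set T, hahn_decomposition nu PN.1 PN.2.
Proof. by have [P [N PN]] := Hahn_decomposition nu; exists (P, N). Qed.

Definition hahnP (nu : {charge set T -> \bar R}) := svalP (cid (hahn_exists nu)).

Definition int_charge (nu : {charge set T -> \bar R}) (D : set T)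
    (f : T -> R) : R :=
  (\int[jordan_pos (hahnP nu)]_(x in D) f x) -
  (\int[jordan_neg (hahnP nu)]_(x in D) f x).

Definition supported_in (K : set T) (nu : set T -> \bar R) : Prop :=
  forall A, measurable A -> A `&` K = set0 -> nu A = 0%E.

End charges.

(* For the family of coordinates of a vector-valued measure, the sum of the
   variations is the total variation for the l^1 norm. *)
Section total_variation.
Context {R : realType} {d : measure_display} {T : measurableType d} {I : finType}.
Variable nu : I -> {charge set T -> \bar R}.
Local Open Scope ereal_scope.

Definition tvar (A : set T) : \bar R :=
  \sum_(i : I) charge_variation (hahnP (nu i)) A.

Let tvar0 : tvar set0 = 0.
Proof. by rewrite /tvar big1// => i _; rewrite measure0. Qed.

Let tvar_ge0 A : 0 <= tvar A.
Proof. by apply: sume_ge0 => i _; exact: measure_ge0. Qed.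

Let tvar_sigma_additive : semi_sigma_additive tvar.
Proof.
move=> F mF tF mUF; rewrite [X in _ --> X](_ : _ =
    lim ((fun n => \sum_(0 <= i < n) tvar (F i)) @ \oo)).
  by apply: is_cvg_ereal_nneg_natsum => k _; exact: tvar_ge0.
rewrite nneseries_sum//; apply: eq_bigr => /= i _.
exact: measure_semi_bigcup.
Qed.

HB.instance Definition _ :=
  isMeasure.Build _ _ _ tvar tvar0 tvar_ge0 tvar_sigma_additive.

Let tvar_finite : fin_num_fun tvar.
Proof. by move=> A mA; apply/sum_fin_numP => i _ _; exact: fin_num_measure. Qed.

HB.instance Definition _ := @Measure_isFinite.Build _ _ _ tvar tvar_finite.

End total_variation.

Section matrix_measures.
Context {R : realType} {d : measure_display} {T : measurableType d}.

Definition mxcharge m n := 'I_m -> 'I_n -> {charge set T -> \bar R}.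

Definition mx_supported_in m n (K : set T) (nu : mxcharge m n) : Prop :=
  forall i j, supported_in K (nu i j).

Definition mx_dominated m n (nu : mxcharge m n) (lam : set T -> \bar R) : Prop :=
  forall i j, nu i j `<< lam.

Definition mx_val m n (nu : mxcharge m n) (A : set T) : 'M[R]_(m, n) :=
  \matrix_(i, j) fine (nu i j A).

(* Meaningful only when [lam] dominates [nu]. *)
Definition mx_density m n (nu : mxcharge m n)
    (lam : {finite_measure set T -> \bar R}) (x : T) : 'M[R]_(m, n) :=
  \matrix_(i, j) fine (Radon_Nikodym (nu i j) lam x).

Definition int_mx m n (nu : mxcharge m n) (D : set T) (F : T -> 'M[R]_(m, n)) : R :=
  \sum_(i < m) \sum_(j < n) int_charge (nu i j) D (fun x => F x i j).

Definition psd_measure_on n (K : set T) (nu : mxcharge n n) : Prop :=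
  mx_supported_in K nu /\ forall A, measurable A -> psd (mx_val nu A).

End matrix_measures.
Arguments mxcharge R {d} T m n.

Section action.
Context {R : realType} {d : measure_display} {T : measurableType d} {n k : nat}.

Record xmeasure := XMeasure {
  xG : mxcharge R T n n ;
  xq : mxcharge R T n k ;
  xR : mxcharge R T n n }.

(* [mu] is a measure on [K] with values in S^n x R^(n x k) x M^n. *)
Definition xmeasure_on (K : set T) (mu : xmeasure) : Prop :=
  [/\ mx_supported_in K (xG mu), mx_supported_in K (xq mu),
      mx_supported_in K (xR mu) &
      forall A, measurable A -> symmx (mx_val (xG mu) A)].

Definition xcoord (mu : xmeasure) (i : 'I_n * 'I_n + 'I_n * 'I_k + 'I_n * 'I_n) :
    {charge set T -> \bar R} :=
  match i with
  | inl (inl p) => xG mu p.1 p.2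
  | inl (inr p) => xq mu p.1 p.2
  | inr p => xR mu p.1 p.2
  end.

Definition Jfun (L1 : 'M[R]_k) (L2 : 'M[R]_n)
    (X : 'M[R]_n) (Y : 'M[R]_(n, k)) (Z : 'M[R]_n) : \bar R :=
  if `[< [/\ psd X, ran_sub Y^T L1 & ran_sub (row_mx Y Z) X] >] then
    (2^-1 * mxdot (Y *m mpinv L1) (mpinv X *m Y *m mpinv L1) +
     2^-1 * mxdot (Z *m invmx L2) (mpinv X *m Z *m invmx L2))%:E
  else +oo%E.

Definition action_wrt (lam : {finite_measure set T -> \bar R})
    (L1 : 'M[R]_k) (L2 : 'M[R]_n) (K : set T) (mu : xmeasure) : \bar R :=
  (\int[lam]_(x in K) Jfun L1 L2 (mx_density (xG mu) lam x)
     (mx_density (xq mu) lam x) (mx_density (xR mu) lam x))%E.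

(* [Jfun L1 L2] being positively 1-homogeneous, [action_wrt lam] is the same for
   all finite [lam] dominating [mu]; the total variation of [mu] is one. *)
Definition action (L1 : 'M[R]_k) (L2 : 'M[R]_n) (K : set T) (mu : xmeasure) :
    \bar R :=
  action_wrt (tvar (xcoord mu)) L1 L2 K mu.

End action.
Arguments xmeasure R {d} T n k.

Section domains.
Context {R : realType} {d : nat}.

Definition partial (j : 'I_d) (f : 'rV[R]_d -> R) : 'rV[R]_d -> R :=
  'D_(delta_mx 0 j) f.

Definition smooth_on (U : set 'rV[R]_d) (f : 'rV[R]_d -> R) : Prop :=
  forall (s : seq 'I_d) x, U x -> differentiable (foldr partial f s) x.

(* Near each boundary point, the closed set [Omega] is a sublevel set of a smooth
   function with nonvanishing differential. *)
Definition smooth_boundary (Omega : set 'rV[R]_d) : Prop :=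
  forall x, Omega x -> ~ Omega° x ->
  exists (U : set 'rV[R]_d) (rho : 'rV[R]_d -> R),
    [/\ open U, U x, smooth_on U rho, exists v, 'D_v rho x != 0 &
        forall y, U y -> (Omega y <-> rho y <= 0)].

Definition smooth_domain (Omega : set 'rV[R]_d) : Prop :=
  [/\ compact Omega, Omega° !=set0 & smooth_boundary Omega].

Definition cylinder (Omega : set 'rV[R]_d) : set (R * 'rV[R]_d) :=
  `[0, 1]%classic `*` Omega.

End domains.

Section continuity_equation.
Context {R : realType} {n k d : nat}.

(* [Phi] is in C^1(Q, S^n); [Phit] and [Phix j] are the continuous extensions to
   [Q] of its partial derivatives in t and x_j. *)
Definition C1_sym (Q : set (R * 'rV[R]_d)) (Phi Phit : R * 'rV[R]_d -> 'M[R]_n)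
    (Phix : 'I_d -> R * 'rV[R]_d -> 'M[R]_n) : Prop :=
  [/\ forall z, Q z -> symmx (Phi z),
      {within Q, continuous Phi},
      {within Q, continuous Phit},
      forall j, {within Q, continuous (Phix j)} &
      forall z, Q° z ->
        is_derive z (1, 0) Phi (Phit z) /\
        forall j, is_derive z (0, delta_mx 0 j) Phi (Phix j z)].

(* The operators are only ever applied to symmetric matrices; every linear map on
   S^n extends to M^n. *)
Definition Dstar (L0 : {linear 'M[R]_n -> 'M[R]_(n, k)})
    (L : 'I_d -> {linear 'M[R]_n -> 'M[R]_(n, k)})
    (Phi : R * 'rV[R]_d -> 'M[R]_n) (Phix : 'I_d -> R * 'rV[R]_d -> 'M[R]_n)
    (z : R * 'rV[R]_d) : 'M[R]_(n, k) :=
  L0 (Phi z) + \sum_(j < d) L j (Phix j z).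

Definition CE (L0 : {linear 'M[R]_n -> 'M[R]_(n, k)})
    (L : 'I_d -> {linear 'M[R]_n -> 'M[R]_(n, k)}) (Omega : set 'rV[R]_d)
    (G0 G1 : mxcharge R 'rV[R]_d n n) (mu : xmeasure R (R * 'rV[R]_d)%type n k) : Prop :=
  xmeasure_on (cylinder Omega) mu /\
  forall Phi Phit Phix, C1_sym (cylinder Omega) Phi Phit Phix ->
    int_mx (xG mu) (cylinder Omega) Phit +
    int_mx (xq mu) (cylinder Omega) (Dstar L0 L Phi Phix) +
    int_mx (xR mu) (cylinder Omega) Phi =
    int_mx G1 Omega (fun x => Phi (1, x)) - int_mx G0 Omega (fun x => Phi (0, x)).

Definition WB2 (L0 : {linear 'M[R]_n -> 'M[R]_(n, k)})
    (L : 'I_d -> {linear 'M[R]_n -> 'M[R]_(n, k)}) (Omega : set 'rV[R]_d)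
    (L1 : 'M[R]_k) (L2 : 'M[R]_n) (G0 G1 : mxcharge R 'rV[R]_d n n) : \bar R :=
  ereal_inf [set action L1 L2 (cylinder Omega) mu | mu in CE L0 L Omega G0 G1].

End continuity_equation.

(* Main.v *)
(* Write [S_i] for the positive semidefinite square root of the density of [G_i]
   and put [Q_t = (1 - t) S_0 + t S_1], [B = S_1 - S_0].  The curve [t |-> Q_t^2]
   joins the two densities and its derivative is the symmetric part of [2 Q_t B],
   so [(Q_t^2, 0, 2 Q_t B) dt lam] solves the continuity equation.  Its action
   density [2 |Q_t (Q_t^2)^+ Q_t B L2^-1|^2] is at most [2 |B L2^-1|^2], because
   [Q_t (Q_t^2)^+ Q_t] is an orthogonal projection.  Replacing [L1] by [0] only
   increases the action, which gives the first inequality. *)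
From HB Require Import structures.
Require Import Defs.
From mathcomp Require Import all_boot all_order all_algebra.
From mathcomp Require Import all_classical all_reals all_analysis measurable_realfun.
From mathcomp Require Import ring lra.

Set Implicit Arguments.
Unset Strict Implicit.
Unset Printing Implicit Defensive.

Import Order.TTheory GRing.Theory Num.Theory.
Import numFieldNormedType.Exports.

Local Open Scope classical_set_scope.
Local Open Scope ring_scope.

(** * Positive semidefinite matrices *)

(** Interpolating the roots instead of the densities keeps the action finite where a density
    degenerates: if [G_0 = 0], the straight line [t G_1] has an action density of order [1 / t],
    while the curve [(t S_1)^2] has rate [2 t S_1^2] and a bounded action density. The constant 2 is
    one half of the square of the 2 in [2 Q_t B]; the factor [|L2^-1|^2] comes from
    submultiplicativity of the Frobenius norm. Two obstacles shape the development. The roots must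
    exist and must depend measurably on the point; a single monotone iteration of polynomials in the
    matrix gives both, as a pointwise limit of measurable maps. Moreover [action] integrates against
    the total variation of the path, whose density [H] relative to [dt lam] is not explicit. Where
    [H > 0], the densities relative to the total variation are those relative to [dt lam] divided by
    [H], and homogeneity of [Jfun] turns this into a single factor [H^-1], which the change of
    measure absorbs. Measurability of the action integrand is never established: only its measurable
    upper bound is integrated explicitly. *)

Section psd_theory.
Context {R : realType}.
Implicit Types n : nat.

Definition qform n (v : 'rV[R]_n) (A : 'M[R]_n) : R := (v *m A *m v^T) 0 0.

Lemma qformD n (v : 'rV[R]_n) A B : qform v (A + B) = qform v A + qform v B.
Proof. by rewrite /qform mulmxDr mulmxDl mxE. Qed.

Lemma qformN n (v : 'rV[R]_n) A : qform v (- A) = - qform v A.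
Proof. by rewrite /qform mulmxN mulNmx mxE. Qed.

Lemma qformZ n (v : 'rV[R]_n) c A : qform v (c *: A) = c * qform v A.
Proof. by rewrite /qform -scalemxAr -scalemxAl mxE. Qed.

Lemma qformE n (v : 'rV[R]_n) A :
  qform v A = \sum_j \sum_i v 0 i * A i j * v 0 j.
Proof.
rewrite /qform mxE; apply: eq_bigr => j _; rewrite !mxE mulr_suml.
by apply: eq_bigr.
Qed.

Lemma qform1 n (v : 'rV[R]_n) : qform v 1%:M = \sum_i v 0 i ^+ 2.
Proof.
by rewrite /qform mulmx1 mxE; apply: eq_bigr => i _; rewrite mxE expr2.
Qed.

Lemma qform_conj n m (v : 'rV[R]_n) (B : 'M[R]_(n, m)) A :
  qform v (B *m A *m B^T) = qform (v *m B) A.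
Proof. by rewrite /qform trmx_mul !mulmxA. Qed.

Lemma qform_gt0 n (v : 'rV[R]_n) : v != 0 -> 0 < qform v 1%:M.
Proof.
move=> v0; rewrite qform1 lt0r; apply/andP; split; last first.
  by apply: sumr_ge0 => i _; rewrite sqr_ge0.
apply: contra v0 => /eqP v20; apply/eqP/matrixP => i j; rewrite !mxE ord1.
have /(_ j isT)/eqP := psumr_eq0P (fun i _ => sqr_ge0 (v 0 i)) v20.
by rewrite sqrf_eq0 => /eqP.
Qed.

Lemma psdP n (A : 'M[R]_n) : psd A <-> A^T = A /\ forall v, 0 <= qform v A.
Proof. by []. Qed.

Lemma psd0 n : psd (0 : 'M[R]_n).
Proof.
split; first by rewrite /symmx trmx0.
by move=> v; rewrite mulmx0 mul0mx mxE.
Qed.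

Lemma psd1 n : psd (1%:M : 'M[R]_n).
Proof.
apply/psdP; split=> [|v]; first by rewrite trmx1.
by rewrite qform1; apply: sumr_ge0 => i _; rewrite sqr_ge0.
Qed.

Lemma psdD n (A B : 'M[R]_n) : psd A -> psd B -> psd (A + B).
Proof.
move=> [sA pA] [sB pB]; split; first by rewrite /symmx linearD/= sA sB.
by move=> v; rewrite -/(qform _ _) qformD addr_ge0//; [exact: pA|exact: pB].
Qed.

Lemma psdZ n (c : R) (A : 'M[R]_n) : 0 <= c -> psd A -> psd (c *: A).
Proof.
move=> c0 [sA pA]; split; first by rewrite /symmx linearZ/= sA.
by move=> v; rewrite -/(qform _ _) qformZ mulr_ge0//; exact: pA.
Qed.

Lemma psd_conj n m (B : 'M[R]_(n, m)) (A : 'M[R]_m) : psd A -> psd (B *m A *m B^T).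
Proof.
move=> [sA pA]; split; first by rewrite /symmx !trmx_mul trmxK sA mulmxA.
by move=> v; rewrite -/(qform _ _) qform_conj; exact: pA.
Qed.

Lemma psd_sqr n (B : 'M[R]_n) : symmx B -> psd (B *m B).
Proof.
move=> sB; rewrite -[X in _ *m X]sB -[X in X *m B^T]mulmx1.
exact/psd_conj/psd1.
Qed.

(** Transposing the four Penrose equations of a symmetric [A] gives them for the transposed
    pseudoinverse; uniqueness concludes. *)
Lemma symmx_mpinv n (A : 'M[R]_n) : symmx A -> symmx (mpinv A).
Proof.
move=> sA; have [ABA BAB sAB sBA] := mpinvP A.
apply: (@is_mpinv_uniq _ _ _ A) => //; split.
- by rewrite -[X in X *m _ *m _]sA -[X in _ *m X]sA -!trmx_mul mulmxA ABA.
- by rewrite -[X in _ *m X *m _]sA -!trmx_mul mulmxA BAB.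
- by rewrite /symmx -[X in X *m _]sA -trmx_mul sBA.
- by rewrite /symmx -[X in _ *m X]sA -trmx_mul sAB.
Qed.

(** The pseudoinverse [B] equals [B A B] and is symmetric, so it is a congruence of [A]. *)
Lemma psd_mpinv n (A : 'M[R]_n) : psd A -> psd (mpinv A).
Proof.
move=> pA; have [sA _] := pA; have [_ BAB _ _] := mpinvP A.
by rewrite -BAB -[X in _ *m X](symmx_mpinv sA); exact: psd_conj.
Qed.

Lemma qform_delta n (A : 'M[R]_n) i : qform (delta_mx 0 i) A = A i i.
Proof. by rewrite /qform -rowE trmx_delta -colE !mxE. Qed.

Lemma mxtrace_psd_ge0 n (A : 'M[R]_n) : psd A -> 0 <= \tr A.
Proof.
by move=> [_ pA]; apply: sumr_ge0 => i _; rewrite -qform_delta; exact: pA.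
Qed.

Lemma mxdot_psd_ge0 n m (X : 'M[R]_n) (A : 'M[R]_(n, m)) :
  psd X -> 0 <= mxdot A (X *m A).
Proof.
move=> pX; rewrite /mxdot mulmxA -[X in _ *m X]trmxK.
exact/mxtrace_psd_ge0/psd_conj.
Qed.

Lemma mxdot_ge0 m n (A : 'M[R]_(m, n)) : 0 <= mxdot A A.
Proof. by have := mxdot_psd_ge0 A (psd1 _); rewrite mul1mx. Qed.

Lemma frob_sqr m n (A : 'M[R]_(m, n)) : frob A ^+ 2 = mxdot A A.
Proof. by rewrite /frob sqr_sqrtr// mxdot_ge0. Qed.

Lemma mxdotE m n (A B : 'M[R]_(m, n)) :
  mxdot A B = \sum_j \sum_i A i j * B i j.
Proof.
by rewrite /mxdot /mxtrace; apply: eq_bigr => j _; rewrite mxE;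
  apply: eq_bigr => i _; rewrite mxE.
Qed.

(* Testing against [v + s w] for all real [s], with [w = v A], kills the cross
   term [2 s w A v^T]. *)
Lemma psd_qform_eq0 n (A : 'M[R]_n) v : psd A -> qform v A = 0 -> v *m A = 0.
Proof.
move=> [sA pA] vA0; pose w := v *m A.
have wAv : (w *m A *m v^T) 0 0 = qform w 1%:M.
  by rewrite /qform mulmx1 -mulmxA -[X in X *m v^T]sA -trmx_mul.
apply/eqP; apply: contraT => /qform_gt0; rewrite -/w => w0.
have key s : qform (v + s *: w) A = 2 * s * qform w 1%:M + s ^+ 2 * qform w A.
  pose b (x y : 'rV[R]_n) := (x *m A *m y^T) 0 0.
  have bDl x y z : b (x + y) z = b x z + b y z by rewrite /b !mulmxDl mxE.
  have bDr x y z : b z (x + y) = b z x + b z y.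
    by rewrite /b linearD/= !mulmxDr mxE.
  have bZl c x y : b (c *: x) y = c * b x y by rewrite /b -!scalemxAl mxE.
  have bZr c x y : b x (c *: y) = c * b x y.
    by rewrite /b linearZ/= -!scalemxAr mxE.
  rewrite -[LHS]/(b _ _) bDl !bDr !bZl !bZr -[b v v]/(qform v A) vA0.
  rewrite [b w v]wAv -[b w w]/(qform w A).
  have -> : b v w = qform w 1%:M by rewrite /b /qform mulmx1.
  by ring.
have wA0 : 0 <= qform w A by exact: pA.
pose s := - (qform w 1%:M / (1 + qform w A)).
have := pA (v + s *: w); rewrite -/(qform _ _) key leNgt => /negP[].
have c0 : 0 < 1 + qform w A by lra.
have -> : 2 * s * qform w 1%:M + s ^+ 2 * qform w A =
   - (qform w 1%:M ^+ 2 * (2 + qform w A)) / (1 + qform w A) ^+ 2.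
  by rewrite /s; field; lra.
rewrite mulNr oppr_lt0 divr_gt0// ?exprn_gt0// mulr_gt0 ?exprn_gt0//; lra.
Qed.

(** The trace sums the values of the form of [B] at the rows of [D]; these are nonnegative, so each
    vanishes and every row is killed by [B]. *)
Lemma psd_mxtrace_eq0 n (D B : 'M[R]_n) :
  psd B -> \tr (D *m B *m D^T) = 0 -> D *m B = 0.
Proof.
move=> pB /psumr_eq0P t0; have [_ pDBD] := psd_conj D pB.
apply/row_matrixP => i; rewrite row0 row_mul; apply: psd_qform_eq0 => //.
rewrite rowE -qform_conj qform_delta; apply: t0 => // j _.
by rewrite -qform_delta; exact: pDBD.
Qed.

(** With [D = B - C], equality of the squares gives [B D = - D C]. The traces of [D B D] and [D C D]
    are then opposite and both nonnegative, hence zero; so [D B = D C = 0] and [D D = 0]. *)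
Lemma psd_sqr_inj n (B C : 'M[R]_n) :
  psd B -> psd C -> B *m B = C *m C -> B = C.
Proof.
move=> pB pC BC; have [sB _] := pB; have [sC _] := pC.
pose D := B - C; have sD : D^T = D by rewrite /D linearB/= sB sC.
have BD : B *m D = - (D *m C).
  by rewrite /D mulmxBr mulmxBl BC opprB.
have t0 : \tr (D *m B *m D^T) + \tr (D *m C *m D^T) = 0.
  by rewrite sD -[D *m B *m D]mulmxA BD mulmxN linearN/= mxtrace_mulC addNr.
have tB := mxtrace_psd_ge0 (psd_conj D pB).
have tC := mxtrace_psd_ge0 (psd_conj D pC).
have DB : D *m B = 0 by apply: psd_mxtrace_eq0 => //; lra.
have DC : D *m C = 0 by apply: psd_mxtrace_eq0 => //; lra.
have : D *m D^T = 0 by rewrite sD {2}/D mulmxBr DB DC subrr.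
by move/mulmx_tr_eq0/eqP; rewrite subr_eq0 => /eqP.
Qed.

Lemma psd_sqrtP n (A : 'M[R]_n) : psd (psd_sqrt A).
(* If [A] has no root, [xget] returns its default 0, which is positive semidefinite too. *)
Proof. by rewrite /psd_sqrt; case: xgetP => [B _ []//|_]; exact: psd0. Qed.

Lemma psd_sqrt_eq n (A B : 'M[R]_n) : psd B -> B *m B = A -> psd_sqrt A = B.
Proof.
move=> pB BA; rewrite /psd_sqrt; case: xgetP => [C _ [pC CA]|/(_ B)[]//].
by apply: psd_sqr_inj => //; rewrite CA.
Qed.

End psd_theory.

(** * The square root as a limit of polynomials *)

Section sqrt_iteration.
Context {R : realType} {n : nat}.
Implicit Types A B M : 'M[R]_n.

(** Polynomials in [M] with nonnegative coefficients. A product of psd matrices need not be psd, but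
    for psd [M] this cone consists of psd matrices and is closed under products. *)
Inductive power_cone M : 'M[R]_n -> Prop :=
| power_cone_pow c m : 0 <= c -> power_cone M (c *: (M ^+ m : 'M[R]_n))
| power_coneD A B : power_cone M A -> power_cone M B -> power_cone M (A + B).

Lemma power_cone0 M : power_cone M 0.
Proof. by rewrite -(scale0r (M ^+ 0 : 'M[R]_n)); exact: power_cone_pow. Qed.

Lemma power_cone1 M : power_cone M M.
Proof. by rewrite -[X in _ X](scale1r (M ^+ 1 : 'M[R]_n)); exact: power_cone_pow. Qed.

Lemma power_coneZ M c A : 0 <= c -> power_cone M A -> power_cone M (c *: A).
Proof.
move=> c0; elim=> [e m e0|B C _ IB _ IC].
  by rewrite scalerA; apply: power_cone_pow; exact: mulr_ge0.
by rewrite scalerDr; exact: power_coneD.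
Qed.

Lemma power_coneM M A B : power_cone M A -> power_cone M B -> power_cone M (A *m B).
Proof.
move=> cA cB; elim: cA => [c m c0|A1 A2 _ I1 _ I2]; last first.
  by rewrite mulmxDl; exact: power_coneD.
elim: cB => [e k e0|B1 B2 _ I1 _ I2]; last first.
  by rewrite mulmxDr; exact: power_coneD.
rewrite -scalemxAl -scalemxAr scalerA -[_ *m _]/((M ^+ m : 'M[R]_n) * _) -exprD.
by apply: power_cone_pow; exact: mulr_ge0.
Qed.

Lemma psd_exp M m : psd M -> psd (M ^+ m : 'M[R]_n).
Proof.
move=> pM; have [sM _] := pM; have sMk k : (M ^+ k : 'M[R]_n)^T = M ^+ k.
  elim: k => [|k IH]; first by rewrite expr0 -[RHS]trmx1.
  by rewrite [in LHS]exprS [LHS]trmx_mul IH sM -[LHS]/(_ * _) -exprSr.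
have sqr k : M ^+ (k + k) = (M ^+ k : 'M[R]_n) *m M ^+ k by rewrite exprD.
(* An even power is a square; an odd one is the congruence [M^k M M^k] of [M]. *)
rewrite -[m]odd_double_half -addnn exprD sqr; case: (odd m); last first.
  by rewrite mul1r; exact: psd_sqr.
rewrite expr1 -[M * _]/(M *m _) mulmxA -[M *m _]/(M * _) -exprS exprSr.
by rewrite -[X in _ *m X]sMk; exact: psd_conj.
Qed.

Lemma power_cone_psd M A : psd M -> power_cone M A -> psd A.
Proof.
move=> pM; elim=> [c m c0|B C _ pB _ pC]; last exact: psdD.
exact/psdZ/psd_exp.
Qed.

(* With [M = 1 - A], the limit [Y] of this iteration solves [(1 - Y)^2 = A]. *)
Fixpoint sqrt_iter M k : 'M[R]_n :=
  if k is k'.+1 then 2^-1 *: (M + sqrt_iter M k' *m sqrt_iter M k') else 0.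

Let half_ge0 : 0 <= 2^-1 :> R. Proof. by rewrite invr_ge0. Qed.

Lemma sqrt_iter_cone M k : power_cone M (sqrt_iter M k).
Proof.
elim: k => [|k IH]; first exact: power_cone0.
by apply: power_coneZ => //; apply: power_coneD (power_cone1 _) _;
  exact: power_coneM.
Qed.

(** Monotonicity of the iteration. Membership in the cone is stronger than positivity and is what
    the induction needs, since the increment is multiplied by iterates in
    [Y^2 - Z^2 = (Y - Z) Y + Z (Y - Z)]. *)
Lemma sqrt_iter_step M k : power_cone M (sqrt_iter M k.+1 - sqrt_iter M k).
Proof.
elim: k => [|k IH]; first by rewrite subr0; exact: sqrt_iter_cone.
rewrite [sqrt_iter M k.+2]/= [X in _ - X]/= -scalerBr.
apply: power_coneZ => //; rewrite opprD addrACA subrr add0r.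
rewrite -[_ *: (M + _)]/(sqrt_iter M k.+1).
set Y := sqrt_iter M k.+1; set Z := sqrt_iter M k.
have -> : Y *m Y - Z *m Z = (Y - Z) *m Y + Z *m (Y - Z).
  by rewrite mulmxBl mulmxBr addrA subrK.
by apply: power_coneD; apply: power_coneM => //; exact: sqrt_iter_cone.
Qed.

Lemma sqrt_iter_le1 M k : psd M -> psd (1%:M - M) -> psd (1%:M - sqrt_iter M k).
Proof.
move=> pM pM1; elim: k => [|k IH]; first by rewrite subr0; exact: psd1.
set Y := sqrt_iter M k in IH *; rewrite /= -/Y.
have pY : psd Y by exact/(power_cone_psd pM)/sqrt_iter_cone.
have [sY _] := pY; have sY1 : (1%:M - Y)^T = 1%:M - Y by have [] := IH.
(* Here [1 - Y^2] is split as [(1 - Y) + (Y - Y^2)], and [Y - Y^2] equals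
   [Y (1 - Y) Y + (1 - Y) Y (1 - Y)], a sum of two congruences. *)
have -> : 1%:M - 2^-1 *: (M + Y *m Y) =
    2^-1 *: ((1%:M - M) + ((1%:M - Y) +
      (Y *m (1%:M - Y) *m Y^T + (1%:M - Y) *m Y *m (1%:M - Y)^T))).
  rewrite sY sY1 !(mulmxBl, mulmxBr) !mul1mx !mulmx1.
  move: (Y *m Y *m Y) (Y *m Y) (1%:M : 'M[R]_n) => Y3 Y2 E.
  by apply/matrixP => i j; rewrite !mxE; field.
by apply/psdZ/psdD => //; apply/psdD => //; apply/psdD; exact: psd_conj.
Qed.

(** Polarization carries the monotone convergence of the quadratic forms over to the entries. *)
Lemma symmx_polar M i j : M^T = M ->
  M i j = 2^-1 * (qform (delta_mx 0 i + delta_mx 0 j) M - M i i - M j j).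
Proof.
move=> sM; rewrite /qform linearD/= !mulmxDl !mulmxDr !trmx_delta -!rowE -!colE.
rewrite !mxE; have -> : M j i = M i j by rewrite -{1}sM mxE.
by field.
Qed.

Lemma cvg_qform (Y_ : nat -> 'M[R]_n) (Y : 'M[R]_n) v :
  (forall i j, Y_ k i j @[k --> \oo] --> Y i j) ->
  qform v (Y_ k) @[k --> \oo] --> qform v Y.
Proof.
move=> cY; rewrite qformE; under eq_fun do rewrite qformE.
apply: cvg_big => [|j _]; first exact: add_continuous.
apply: cvg_big => [|i _]; first exact: add_continuous.
by apply: cvgMr_tmp; apply: cvgMl_tmp; exact: cY.
Qed.

Definition sqrt_iter_lim M : 'M[R]_n :=
  \matrix_(i, j) lim (sqrt_iter M k i j @[k --> \oo]).

Section limit.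
Variable M : 'M[R]_n.
Hypotheses (pM : psd M) (pM1 : psd (1%:M - M)).

Let qform_cvg v : cvg (qform v (sqrt_iter M k) @[k --> \oo]).
Proof.
apply: nondecreasing_is_cvgn.
  apply/nondecreasing_seqP => k; rewrite -subr_ge0 -qformN -qformD.
  by have [_] := power_cone_psd pM (sqrt_iter_step M k); exact.
exists (qform v 1%:M) => _ [k _ <-]; rewrite -subr_ge0 -qformN -qformD.
by have [_] := sqrt_iter_le1 k pM pM1; exact.
Qed.

Lemma sqrt_iter_cvg i j :
  sqrt_iter M k i j @[k --> \oo] --> sqrt_iter_lim M i j.
Proof.
rewrite mxE; under eq_fun.
  move=> k; rewrite symmx_polar; last first.
    by have [] := power_cone_psd pM (sqrt_iter_cone M k).
  rewrite -!qform_delta; over.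
apply: is_cvgMl_tmp; apply: is_cvgB; first apply: is_cvgB; exact: qform_cvg.
Qed.

Lemma sqrt_iter_lim_fixed :
  sqrt_iter_lim M = 2^-1 *: (M + sqrt_iter_lim M *m sqrt_iter_lim M).
Proof.
apply/matrixP => i j; apply: (@cvg_unique _ _ (sqrt_iter M k.+1 i j @[k --> \oo])).
- exact: norm_hausdorff.
- by have := @sqrt_iter_cvg i j; rewrite -(cvg_shiftS (fun k => sqrt_iter M k i j)).
- rewrite 3!mxE (_ : (fun k => _) = (fun k => 2^-1 * (M i j +
    \sum_l sqrt_iter M k i l * sqrt_iter M k l j))); last first.
    by apply/funext => k; rewrite /= !mxE.
  apply: cvgMl_tmp; apply: cvgD; first exact: cvg_cst.
  apply: cvg_big => [|l _]; first exact: add_continuous.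
  by apply: cvgM; exact: sqrt_iter_cvg.
Qed.

Lemma psd_sub_sqrt_iter_lim : psd (1%:M - sqrt_iter_lim M).
Proof.
apply/psdP; split=> [|v].
  rewrite linearB/= trmx1; congr (_ - _); apply/matrixP => i j; rewrite !mxE.
  rewrite (_ : (fun k => sqrt_iter M k j i) = fun k => sqrt_iter M k i j)//.
  apply/funext => k; have [+ _] := power_cone_psd pM (sqrt_iter_cone M k).
  by move=> /matrixP/(_ i j); rewrite mxE.
rewrite qformD qformN subr_ge0; apply: (cvgr_to_le (@cvg_qform _ _ v sqrt_iter_cvg)).
apply: nearW => k; rewrite -subr_ge0 -qformN -qformD.
by have [_] := sqrt_iter_le1 k pM pM1; exact.
Qed.

Lemma sqr_sub_sqrt_iter_lim :
  (1%:M - sqrt_iter_lim M) *m (1%:M - sqrt_iter_lim M) = 1%:M - M.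
Proof.
set Y := sqrt_iter_lim M.
have YY : Y *m Y = 2 *: Y - M.
  rewrite [in RHS]/Y sqrt_iter_lim_fixed scalerA divff ?pnatr_eq0// scale1r.
  by rewrite addrC addKr.
rewrite mulmxBl !mulmxBr !mul1mx !mulmx1 YY scaler_nat mulr2n.
by apply/matrixP => i j; rewrite !mxE; ring.
Qed.

End limit.

(** An upper bound for the quadratic form of [A] on unit vectors that is measurable in the entries.
    The summand 1 makes it positive at [A = 0], so that one may divide by it. *)
Definition mxl1 A : R := 1 + \sum_i \sum_j `|A i j|.

Lemma mxl1_gt0 A : 0 < mxl1 A.
Proof.
by rewrite ltr_pwDl//; apply: sumr_ge0 => i _; apply: sumr_ge0 => j _.
Qed.

Lemma qform_le_mxl1 v A : qform v A <= mxl1 A * qform v 1%:M.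
Proof.
rewrite qformE qform1; set s := \sum_i v 0 i ^+ 2.
have vs i : `|v 0 i| ^+ 2 <= s.
  rewrite real_normK ?num_real// /s (bigD1 i)//= lerDl.
  by apply: sumr_ge0 => j _; exact: sqr_ge0.
have s0 : 0 <= s by apply: sumr_ge0 => j _; exact: sqr_ge0.
rewrite /mxl1 mulrDl mul1r exchange_big/= mulr_suml.
apply: (@le_trans _ _ (\sum_i (\sum_j `|A i j|) * s)); last by rewrite lerDr.
apply: ler_sum => i _; rewrite mulr_suml; apply: ler_sum => j _.
apply: (le_trans (ler_norm _)); rewrite !normrM mulrAC mulrC ler_wpM2l//.
have := vs i; have := vs j; have := sqr_ge0 (`|v 0 i| - `|v 0 j|); nra.
Qed.

(** Dividing a psd [A] by [mxl1 A] brings it between 0 and the identity, where the iteration with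
    [M = 1 - A / mxl1 A] converges; the outer factor undoes the scaling. *)
Definition sqrt_approx A k : 'M[R]_n :=
  Num.sqrt (mxl1 A) *: (1%:M - sqrt_iter (1%:M - (mxl1 A)^-1 *: A) k).

Section psd_sqrt_approx.
Variable A : 'M[R]_n.
Hypothesis pA : psd A.

Let pM1 : psd (1%:M - (1%:M - (mxl1 A)^-1 *: A)).
Proof.
by rewrite opprB addrC subrK; apply: psdZ => //; rewrite invr_ge0 ltW// mxl1_gt0.
Qed.

Let pM : psd (1%:M - (mxl1 A)^-1 *: A).
Proof.
have [sA _] := pA; apply/psdP; split=> [|v].
  by rewrite linearB linearZ/= trmx1 sA.
rewrite qformD qformN qformZ subr_ge0 ler_pdivrMl ?mxl1_gt0//.
exact: qform_le_mxl1.
Qed.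

Let sqrtA : psd_sqrt A =
  Num.sqrt (mxl1 A) *: (1%:M - sqrt_iter_lim (1%:M - (mxl1 A)^-1 *: A)).
Proof.
apply: psd_sqrt_eq; first by apply: psdZ => //; exact: psd_sub_sqrt_iter_lim.
rewrite -scalemxAl -scalemxAr scalerA sqr_sub_sqrt_iter_lim//.
rewrite -expr2 sqr_sqrtr ?ltW ?mxl1_gt0// opprB addrC subrK scalerA divff ?scale1r//.
by rewrite gt_eqF// mxl1_gt0.
Qed.

Lemma psd_sqrt_sqr : psd_sqrt A *m psd_sqrt A = A.
Proof.
rewrite sqrtA -scalemxAl -scalemxAr scalerA sqr_sub_sqrt_iter_lim//.
rewrite -expr2 sqr_sqrtr ?ltW ?mxl1_gt0// opprB addrC subrK scalerA divff ?scale1r//.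
by rewrite gt_eqF// mxl1_gt0.
Qed.

Lemma sqrt_approx_cvg i j :
  sqrt_approx A k i j @[k --> \oo] --> psd_sqrt A i j.
Proof.
rewrite sqrtA mxE; under eq_fun do rewrite mxE.
apply: cvgMl_tmp; rewrite mxE; under eq_fun do rewrite mxE.
apply: cvgD; first exact: cvg_cst.
rewrite mxE; under eq_fun do rewrite mxE.
by apply: cvgN; exact: sqrt_iter_cvg.
Qed.

End psd_sqrt_approx.
End sqrt_iteration.

(** * Measurability of matrix-valued maps *)

Section measurable_matrices.
Context {R : realType} {d : measure_display} {T : measurableType d}.

Definition mx_measurable m n (F : T -> 'M[R]_(m, n)) :=
  forall i j, measurable_fun setT (fun x => F x i j).

Lemma mx_measurable_cst m n (A : 'M[R]_(m, n)) : mx_measurable (fun=> A).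
Proof. by move=> i j; exact: measurable_cst. Qed.

Lemma mx_measurableD m n (F G : T -> 'M[R]_(m, n)) :
  mx_measurable F -> mx_measurable G -> mx_measurable (fun x => F x + G x).
Proof.
by move=> mF mG i j; under eq_fun do rewrite mxE; exact: measurable_funD.
Qed.

Lemma mx_measurableN m n (F : T -> 'M[R]_(m, n)) :
  mx_measurable F -> mx_measurable (fun x => - F x).
Proof.
by move=> mF i j; under eq_fun do rewrite mxE; exact: measurable_funN.
Qed.

Lemma mx_measurableZ m n (c : T -> R) (F : T -> 'M[R]_(m, n)) :
  measurable_fun setT c -> mx_measurable F -> mx_measurable (fun x => c x *: F x).
Proof.
by move=> mc mF i j; under eq_fun do rewrite mxE; exact: measurable_funM.
Qed.

Lemma mx_measurableM m n p (F : T -> 'M[R]_(m, n)) (G : T -> 'M[R]_(n, p)) :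
  mx_measurable F -> mx_measurable G -> mx_measurable (fun x => F x *m G x).
Proof.
move=> mF mG i j; under eq_fun do rewrite mxE.
by apply: measurable_sum => k; exact: measurable_funM.
Qed.

Lemma mx_measurable_psd_sqrt n (F : T -> 'M[R]_n) :
  (forall x, psd (F x)) -> mx_measurable F ->
  mx_measurable (fun x => psd_sqrt (F x)).
Proof.
move=> pF mF i j.
apply: (@measurable_fun_cvg _ _ _ _ (fun k x => sqrt_approx (F x) k i j)); last first.
  by move=> x _; exact: sqrt_approx_cvg.
move=> k; have mc : measurable_fun setT (fun x => mxl1 (F x)).
  apply: measurable_funD; first exact: measurable_cst.
  apply: measurable_sum => a; apply: measurable_sum => b.
  exact: (measurableT_comp (@normr_measurable R setT)).
apply: mx_measurableZ.
  exact: (measurableT_comp (continuous_measurable_fun (@sqrt_continuous R))).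
apply: mx_measurableD; first exact: mx_measurable_cst.
apply: mx_measurableN; elim: k => [|k IH]; first exact: mx_measurable_cst.
apply: mx_measurableZ; first exact: measurable_cst.
apply: mx_measurableD; last exact: mx_measurableM.
apply: mx_measurableD; first exact: mx_measurable_cst.
apply: mx_measurableN; apply: mx_measurableZ => //.
(* The inverse of a positive number is a real power, and real powers are measurable. *)
rewrite (_ : (fun x => _) = (fun x => mxl1 (F x) `^ (-1))); last first.
  by apply/funext => x; rewrite powR_inv1// ltW// mxl1_gt0.
exact: (measurableT_comp (measurable_powR _)).
Qed.

End measurable_matrices.

(** * The action density *)

Section action_density.
Context {R : realType} {n k : nat}.
Implicit Types (X Z Q B : 'M[R]_n) (Y : 'M[R]_(n, k)).

Lemma Jfun_ge0 (L1 : 'M[R]_k) L2 X Y Z : (0 <= Jfun L1 L2 X Y Z)%E.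
Proof.
rewrite /Jfun; case: asboolP => [[pX _ _]|_]; last by rewrite leey.
rewrite lee_fin -!mulmxA ![X in mxdot _ X]mulmxA.
by rewrite addr_ge0// mulr_ge0// -?mulmxA mxdot_psd_ge0//; exact: psd_mpinv.
Qed.

(** A finite right-hand side forces [Y = 0], and then the first term is zero for both weights. *)
Lemma Jfun_le0 (L1 : 'M[R]_k) L2 X Y Z : (Jfun L1 L2 X Y Z <= Jfun 0 L2 X Y Z)%E.
Proof.
rewrite [leRHS]/Jfun; case: asboolP => [[pX + rX]|_]; last by rewrite leey.
rewrite /ran_sub trmxK trmx0 => /submx0null Y0.
rewrite /Jfun asboolT; first by rewrite Y0 mulmx0 !mul0mx.
by split=> //; rewrite /ran_sub trmxK Y0 sub0mx.
Qed.

Lemma mpinvZ (c : R) X : c != 0 -> mpinv (c *: X) = c^-1 *: mpinv X.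
Proof.
move=> c0; have [XBX BXB sXB sBX] := mpinvP X.
apply: (is_mpinv_uniq (mpinvP _)); split.
- by rewrite !(=^~ scalemxAl, =^~ scalemxAr) !scalerA XBX; congr (_ *: _); field.
- by rewrite !(=^~ scalemxAl, =^~ scalemxAr) !scalerA BXB; congr (_ *: _); field.
- by rewrite !(=^~ scalemxAl, =^~ scalemxAr) !scalerA ?divff ?mulVf// scale1r.
- by rewrite !(=^~ scalemxAl, =^~ scalemxAr) !scalerA ?divff ?mulVf// scale1r.
Qed.

Lemma mxdotZ m p (c e : R) (A B : 'M[R]_(m, p)) :
  mxdot (c *: A) (e *: B) = c * e * mxdot A B.
Proof.
by rewrite /mxdot [(c *: A)^T]linearZ/= -scalemxAl -scalemxAr scalerA mxtraceZ.
Qed.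

(** For symmetric [Q] the projections [Q Q^+] and [Q^+ Q] coincide. This puts the range of [Q]
    inside that of [Q^2], as the range condition in [Jfun] demands. *)
Lemma sqr_range Q : symmx Q -> Q = Q *m Q *m mpinv Q.
Proof.
move=> sQ; have [QPQ PQP sQP sPQ] := mpinvP Q.
have sP := symmx_mpinv sQ.
by rewrite -mulmxA -sQP trmx_mul sP sQ mulmxA QPQ.
Qed.

(* [Q (Q^2)^+ Q] is an orthogonal projection. *)
Lemma mxdot_proj_le Q (W : 'M[R]_n) : symmx Q ->
  mxdot (Q *m W) (mpinv (Q *m Q) *m (Q *m W)) <= mxdot W W.
Proof.
move=> sQ; have [_ BAB _ _] := mpinvP (Q *m Q).
have [sB _] := psd_mpinv (psd_sqr sQ); set B := mpinv _ in BAB sB *.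
pose P := Q *m B *m Q.
have sP : P^T = P by rewrite /P !trmx_mul sB sQ mulmxA.
have PP : P *m P = P.
  rewrite /P -!mulmxA; congr (Q *m _); rewrite !mulmxA; congr (_ *m Q).
  by rewrite -[in RHS]BAB !mulmxA.
rewrite -subr_ge0.
have -> : mxdot W W - mxdot (Q *m W) (B *m (Q *m W)) =
    mxdot ((1%:M - P) *m W) ((1%:M - P) *m W).
  rewrite /mxdot -linearB/= !trmx_mul sQ [(1%:M - P)^T]linearB/= trmx1 sP; congr (\tr _).
  have PP1 : (1%:M - P) *m (1%:M - P) = 1%:M - P.
    by rewrite mulmxBl !mulmxBr !mul1mx !mulmx1 PP subrr subr0.
  rewrite -[RHS]mulmxA [(1%:M - P) *m (_ *m _)]mulmxA PP1 mulmxBl mul1mx mulmxBr.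
  by rewrite /P !mulmxA.
exact: mxdot_ge0.
Qed.

Lemma frob_mul m p q (A : 'M[R]_(m, p)) (B : 'M[R]_(p, q)) :
  mxdot (A *m B) (A *m B) <= mxdot A A * mxdot B B.
Proof.
have CS (I : finType) (a b : I -> R) :
    (\sum_i a i * b i) ^+ 2 <= (\sum_i a i ^+ 2) * (\sum_i b i ^+ 2).
  (* Lagrange's identity: this double sum is twice the defect in the Cauchy-Schwarz inequality. *)
  have : 0 <= \sum_i \sum_j (a i * b j - a j * b i) ^+ 2.
    by apply: sumr_ge0 => i _; apply: sumr_ge0 => j _; exact: sqr_ge0.
  have -> : \sum_i \sum_j (a i * b j - a j * b i) ^+ 2 =
      \sum_i \sum_j (a i ^+ 2 * b j ^+ 2) + \sum_i \sum_j (b i ^+ 2 * a j ^+ 2)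
      - 2 * \sum_i \sum_j ((a i * b i) * (a j * b j)).
    rewrite mulr_sumr -sumrN -!big_split/=; apply: eq_bigr => i _.
    rewrite mulr_sumr -sumrN -!big_split/=; apply: eq_bigr => j _; ring.
  rewrite -!big_distrlr/= -expr2; lra.
rewrite !mxdotE exchange_big/= [X in X * _]exchange_big/= big_distrl/=.
apply: ler_sum => i _; rewrite big_distrr/=; apply: ler_sum => j _.
rewrite mxE -expr2; apply: (le_trans (CS _ _ _)).
by under [X in _ <= _ * X]eq_bigr do rewrite -expr2;
  under [X in _ <= X * _]eq_bigr do rewrite -expr2.
Qed.

(** [h] will be the density of the total variation of the path relative to [dt lam]. The two rates
    contribute [h^-1] each and the pseudoinverse contributes [h], which leaves [h^-1]. *)
Lemma Jfun_bound (L1 : 'M[R]_k) L2 (h : R) Q B : symmx Q -> 0 < h ->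
  (Jfun L1 L2 (h^-1 *: (Q *m Q)) 0 (h^-1 *: (2 *: (Q *m B))) <=
     (h^-1 * (2 * frob (invmx L2) ^+ 2 * frob B ^+ 2))%:E)%E.
Proof.
move=> sQ h0; have h'0 : h^-1 != 0 by rewrite gt_eqF// invr_gt0.
rewrite /Jfun asboolT; last first.
  split; first by apply: psdZ; [rewrite invr_ge0 ltW|exact: psd_sqr].
    by rewrite /ran_sub trmxK sub0mx.
  rewrite /ran_sub tr_row_mx col_mx_sub linear0 sub0mx/=.
  rewrite {1}(sqr_range sQ) !linearZ/= -!mulmxA trmx_mul.
  rewrite !scalemx_sub//.
  apply/submxP; exists (h *: (mpinv Q *m B)^T).
  rewrite -scalemxAl -scalemxAr scalerA divff ?gt_eqF// scale1r.
  by rewrite !trmx_mul !mulmxA.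
rewrite !mul0mx mulmx0 !mul0mx mpinvZ// invrK lee_fin.
rewrite [mxdot 0 0](_ : _ = 0); last by rewrite /mxdot mulmx0 mxtrace0.
rewrite mulr0 add0r -!scalemxAl -!scalemxAr -!scalemxAl !scalerA mxdotZ.
rewrite -!mulmxA !frob_sqr.
have := mxdot_proj_le (B *m invmx L2) sQ; have := frob_mul B (invmx L2).
set a := mxdot (B *m _) _; set b := mxdot (Q *m _) _.
set c := mxdot B B; set e := mxdot (invmx _) _ => ac ba.
have -> : 2^-1 * (h^-1 * 2 * (h * h^-1 * 2) * b) = h^-1 * (2 * b).
  by field; rewrite gt_eqF.
rewrite ler_pM2l ?invr_gt0// -mulrA ler_pM2l// [e * c]mulrC.
exact: le_trans ba ac.
Qed.

End action_density.

(** * Integrals against charges and Radon-Nikodym derivatives *)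

Section charge_integrals.
Context {d : measure_display} {T : measurableType d} {R : realType}.
Local Open Scope ereal_scope.

(* The integral of a nonnegative function is a supremum over simple functions
   below it, so no measurability is required. *)
Lemma ge0_le_integral_nonmeasurable (mu : {measure set T -> \bar R}) (D : set T)
    (f g : T -> \bar R) :
  (forall x, D x -> 0 <= f x) -> (forall x, D x -> f x <= g x) ->
  \int[mu]_(x in D) f x <= \int[mu]_(x in D) g x.
Proof.
move=> f0 fg; have g0 x : D x -> 0 <= g x.
  by move=> Dx; exact: le_trans (f0 _ Dx) (fg _ Dx).
rewrite !ge0_integralE//; apply: ge_ereal_sup => _ [h hf <-].
apply: ereal_sup_ubound; exists h => // x; apply: (le_trans (hf x)).
by rewrite !patchE; case: ifPn => // /[!inE]; exact: fg.
Qed.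

Lemma Radon_Nikodym_ae_unique (nu : {charge set T -> \bar R})
    (mu : {sigma_finite_measure set T -> \bar R}) (f : T -> \bar R) :
  mu.-integrable setT f ->
  (forall A, measurable A -> nu A = \int[mu]_(x in A) f x) ->
  nu `<< mu -> ae_eq mu setT f (Radon_Nikodym nu mu).
Proof.
move=> intf nuE numu; apply: integral_ae_eq => //.
by move=> A _ mA; rewrite -nuE// -(Radon_Nikodym_integral numu).
Qed.

Lemma integral_charge_dominates (nu : {charge set T -> \bar R})
    (mu : {measure set T -> \bar R}) (f : T -> \bar R) :
  mu.-integrable setT f ->
  (forall A, measurable A -> nu A = \int[mu]_(x in A) f x) -> nu `<< mu.
Proof.
move=> intf nuE; apply/null_content_dominatesP => A mA muA.
rewrite nuE//; apply: null_set_integral => //.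
by apply: measurable_funTS; exact: measurable_int intf.
Qed.

Section int_charge.
Variables (nu : {charge set T -> \bar R}).
Variables (mu : {sigma_finite_measure set T -> \bar R}) (f : T -> R).
Hypothesis intf : mu.-integrable setT (EFin \o f).
Hypothesis nuE : forall A, measurable A -> nu A = \int[mu]_(x in A) (f x)%:E.
Variables (D : set T) (phi : T -> R) (M : R).
Hypothesis mD : measurable D.
Hypothesis mphi : measurable_fun D phi.
Hypothesis phiM : forall x, D x -> (`|phi x| <= M)%R.

Lemma integrable_bounded_mul : mu.-integrable D (EFin \o (fun x => f x * phi x)%R).
Proof.
apply: (@le_integrable _ _ _ mu D mD _ (fun x => (M * f x)%:E)).
- apply/measurable_EFinP; apply: measurable_funM => //.
  by apply/measurable_EFinP/measurable_funTS; exact: measurable_int intf.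
- move=> x Dx /=; rewrite lee_fin !normrM mulrC ler_wpM2r//.
  exact: le_trans (phiM Dx) (ler_norm _).
- apply: (@eq_integrable _ _ _ mu D mD (fun x => M%:E * (f x)%:E)).
    by move=> x _; rewrite EFinM.
  by apply: integrableZl => //; exact: integrableS intf.
Qed.

Let bounded_integrable (m : {finite_measure set T -> \bar R}) :
  m.-integrable D (EFin \o phi).
Proof.
apply: measurable_bounded_integrable => //.
  by rewrite ltey_eq fin_num_measure.
exists M; split; first exact: num_real.
by move=> r Mr x Dx /=; exact: le_trans (phiM Dx) (ltW Mr).
Qed.

(** Both Jordan parts of [nu] are dominated by [mu], so each integral becomes one against [mu]; the
    difference of their Radon-Nikodym derivatives is [f] almost everywhere. Boundedness of [phi]
    secures integrability throughout. *)
Lemma int_chargeE : int_charge nu D phi = (\int[mu]_(x in D) (f x * phi x))%R.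
Proof.
have numu : nu `<< mu by exact: integral_charge_dominates intf nuE.
set PN := hahnP nu.
have jp : jordan_pos PN `<< mu by exact: jordan_pos_dominates.
have jn : jordan_neg PN `<< mu by exact: jordan_neg_dominates.
set cp := charge_of_finite_measure (jordan_pos PN).
set cn := charge_of_finite_measure (jordan_neg PN).
have intR (m : {finite_measure set T -> \bar R}) : m `<< mu ->
    mu.-integrable D (fun x =>
      (phi x)%:E * (Radon_Nikodym (charge_of_finite_measure m) mu) x).
  move=> mmu; set g := Radon_Nikodym _ _.
  have ig : mu.-integrable setT g by exact: Radon_Nikodym_integrable.
  apply: (@le_integrable _ _ _ mu D mD _ (fun x => M%:E * g x)).
  - apply: emeasurable_funM; first exact/measurable_EFinP.
    by apply: measurable_funTS; exact: measurable_int ig.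
  - move=> x Dx /=; rewrite !abseM lee_wpmul2r//= lee_fin.
    exact: le_trans (phiM Dx) (ler_norm _).
  - by apply: integrableZl => //; exact: integrableS ig.
rewrite /int_charge -/PN /Rintegral.
rewrite -(Radon_Nikodym_change_of_variables jp mD (bounded_integrable _)).
rewrite -(Radon_Nikodym_change_of_variables jn mD (bounded_integrable _)).
rewrite -fineB ?integrable_fin_num ?intR// -integralB ?intR//; congr fine.
apply: ae_eq_integral => //.
- by apply: emeasurable_funB; [move: (intR _ jp)|move: (intR _ jn)];
    exact: measurable_int.
- exact: measurable_int integrable_bounded_mul.
have fjpn : ae_eq mu setT (EFin \o f)
    (fun x => (Radon_Nikodym cp mu) x - (Radon_Nikodym cn mu) x).
  have ip : mu.-integrable setT (Radon_Nikodym cp mu) by exact: Radon_Nikodym_integrable.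
  have in_ : mu.-integrable setT (Radon_Nikodym cn mu) by exact: Radon_Nikodym_integrable.
  apply: integral_ae_eq => //.
    by apply: emeasurable_funB; [move: ip|move: in_]; exact: measurable_int.
  move=> A _ mA; rewrite -nuE// integralB//; [|exact: integrableS ip
    |exact: integrableS in_].
  rewrite -!Radon_Nikodym_integral// (jordan_decomp PN mA) /cadd/= cscaleN1.
  by [].
move: fjpn; apply: filterS => x /= /(_ I) fx Dx.
have -> : (f x * phi x)%:E = (phi x)%:E * (f x)%:E by rewrite mulrC EFinM.
by rewrite fx muleBr// fin_num_adde_defr// Radon_Nikodym_fin_num.
Qed.

End int_charge.

(** By the chain rule [f] is almost everywhere the density relative to [tau] times [H], and where
    [H] is positive one may divide. [H] is a version of the density of [tau] that is finite
    everywhere. *)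
Lemma Radon_Nikodym_quotient (nu : {charge set T -> \bar R})
    (tau : {finite_measure set T -> \bar R})
    (rho : {sigma_finite_measure set T -> \bar R}) (f : T -> R) :
  let H := Radon_Nikodym_SigmaFinite.f tau rho in
  rho.-integrable setT (EFin \o f) ->
  (forall A, measurable A -> nu A = \int[rho]_(x in A) (f x)%:E) ->
  nu `<< tau -> tau `<< rho ->
  {ae rho, forall x, 0 < H x ->
    fine (Radon_Nikodym nu tau x) = ((fine (H x))^-1 * f x)%R}.
Proof.
move=> H intf nuE nutau taurho.
have nurho : nu `<< rho by exact: integral_charge_dominates intf nuE.
have h1 := Radon_Nikodym_ae_unique intf nuE nurho.
have h2 := Radon_Nikodym_chain_rule nutau taurho.
have h3 := ae_eq_Radon_Nikodym_SigmaFinite taurho measurableT.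
move: h1 h2 h3; apply: filterS3 => x /(_ I) /= h1 /(_ I) h2 /(_ I) h3 Hx.
have Hfin : H x \is a fin_num by exact: Radon_Nikodym_SigmaFinite.f_fin_num.
have Nfin := Radon_Nikodym_fin_num x nutau.
have : (f x)%:E = Radon_Nikodym nu tau x * H x by rewrite h1 h2 /H h3.
rewrite -{1}(fineK Nfin) -{1}(fineK Hfin) -EFinM => -[->].
by rewrite mulrC mulfK// gt_eqF// fine_gt0// Hx ltey_eq Hfin.
Qed.

(* [F] need not be measurable. *)
Lemma integral_dominated_measure_le (rho : {sigma_finite_measure set T -> \bar R})
    (tau : {finite_measure set T -> \bar R}) (K : set T)
    (F : T -> \bar R) (U : T -> R) (N : set T) :
  let H := Radon_Nikodym_SigmaFinite.f tau rho in
  tau `<< rho -> measurable K -> measurable_fun setT U ->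
  (forall x, 0 <= U x)%R -> (forall x, K x -> 0 <= F x) -> rho.-negligible N ->
  (forall x, K x -> ~ N x -> 0 < H x -> F x <= ((fine (H x))^-1 * U x)%:E) ->
  \int[tau]_(x in K) F x <= \int[rho]_(x in K) (U x)%:E.
Proof.
move=> H taurho mK mU U0 F0 [N' [mN' N'0 NN']] FU.
have H0 x : 0 <= H x by exact: Radon_Nikodym_SigmaFinite.f_ge0.
have Hfin x : H x \is a fin_num by exact: Radon_Nikodym_SigmaFinite.f_fin_num.
have intH : rho.-integrable setT H by exact: Radon_Nikodym_SigmaFinite.f_integrable.
have mH : measurable_fun setT H by exact: measurable_int intH.
(* [tau] does not charge [Z], its mass there being the integral of [H]. *)
pose Z := [set x | H x = 0].
have mZ : measurable Z by rewrite -[Z]setTI; exact: measurable_eqe.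
have tauZ : tau Z = 0.
  rewrite (Radon_Nikodym_SigmaFinite.f_integral taurho)//.
  exact: integral0_eq.
have tauN' : tau N' = 0 by move/null_content_dominatesP : taurho; exact.
pose B := N' `|` Z.
have mB : measurable B by exact: measurableU.
have tauB : tau B = 0 by rewrite measureU0.
(* [F] is controlled only off [B], so its measurable majorant [V] is infinite on [B]; as [B] is
   [tau]-null, [V] and [W] have the same integral. *)
pose V x := if x \in B then +oo else ((fine (H x))^-1 * U x)%:E.
pose W x := ((fine (H x))^-1 * U x)%:E.
have mW : measurable_fun setT W.
  apply/measurable_EFinP/measurable_funM => //.
  rewrite (_ : (fun x => _) = (fun x => fine (H x) `^ (-1))%R); last first.
    by apply/funext => x; rewrite powR_inv1// fine_ge0.
  apply: (measurableT_comp (measurable_powR _)).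
  exact: measurableT_comp.
have W0 x : 0 <= W x.
  by rewrite lee_fin mulr_ge0// invr_ge0 fine_ge0.
apply: (@le_trans _ _ (\int[tau]_(x in K) V x)).
  apply: ge0_le_integral_nonmeasurable => // x Kx; rewrite /V.
  case: ifPn => [_|/negP xB]; first exact: leey.
  have [xN xZ] : ~ N x /\ ~ Z x.
    by split=> h; apply: xB; rewrite inE; [left; exact: NN'|right].
  by apply: FU => //; rewrite lt_neqAle H0 andbT; apply/eqP => /esym.
have -> : \int[tau]_(x in K) V x = \int[tau]_(x in K) W x.
  apply: ge0_ae_eq_integral => //.
  - apply: measurable_funTS; apply: measurable_fun_ifT => //.
    apply: (measurable_fun_bool true); rewrite setTI.
    by rewrite (_ : _ @^-1` _ = B)//; apply/seteqP; split=> x /=;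
      [exact: set_mem|exact: mem_set].
  - exact: measurable_funTS.
  - by move=> x _; rewrite /V; case: ifP => // _; exact: W0.
  - exists B; split=> // x /= /not_implyP[_]; rewrite /V /W.
    by case: ifPn => // /[!inE].
(* After the change of measure the integrand [W H] is [U] where [H > 0], and 0 elsewhere. *)
rewrite -(Radon_Nikodym_SigmaFinite.change_of_variables taurho W0 mK); last first.
  exact: measurable_funTS.
apply: ge0_le_integral_nonmeasurable => x _.
  by rewrite mule_ge0.
rewrite -/H -[H x]fineK// /W -EFinM lee_fin.
have [->|h0] := eqVneq (fine (H x)) 0%R; first by rewrite mulr0.
by rewrite mulrAC mulVf// mul1r.
Qed.

End charge_integrals.

(** * Densities of positive semidefinite matrix measures *)

Section psd_density.
Context {R : realType}.

Lemma rat_seq_cvg (x : R) : exists q : nat -> rat, ratr (q m) @[m --> \oo] --> x.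
Proof.
have qP (m : nat) : exists q : rat, x - m.+1%:R^-1 < ratr q < x + m.+1%:R^-1.
  have xm : x - m.+1%:R^-1 < x + m.+1%:R^-1 by rewrite ltrD2l gt0_cp// invr_gt0.
  by have [q qx] := rat_in_itvoo xm; exists q; rewrite in_itv in qx.
pose q m := sval (cid (qP m)); exists q.
have inv0 : (m.+1%:R^-1 : R) @[m --> \oo] --> 0 by exact: cvg_harmonic.
apply: (@squeeze_cvgr _ _ _ _ (fun m => x - m.+1%:R^-1) (fun m => x + m.+1%:R^-1)).
- by apply: nearW => m; rewrite /q; case: cid => /= r /andP[/ltW -> /ltW ->].
- by rewrite -[X in _ --> X]subr0; apply: cvgB => //; exact: cvg_cst.
- by rewrite -[X in _ --> X]addr0; apply: cvgD => //; exact: cvg_cst.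
Qed.

(** Testing on countably many vectors allows the exceptional null sets, one for each vector, to be
    united. *)
Lemma psd_rat n (A : 'M[R]_n) : A^T = A ->
  (forall v : 'rV[rat]_n, 0 <= qform (map_mx ratr v) A) -> psd A.
Proof.
move=> sA Arat; apply/psdP; split=> // v.
have /choice[q qv] : forall i, exists q : nat -> rat,
  ratr (q m) @[m --> \oo] --> v 0 i by move=> i; exact: rat_seq_cvg.
pose w m : 'rV[rat]_n := \row_i q i m.
have wv : qform (map_mx ratr (w m)) A @[m --> \oo] --> qform v A.
  rewrite qformE; under eq_fun do rewrite qformE.
  apply: cvg_big => [|j _]; first exact: add_continuous.
  apply: cvg_big => [|i _]; first exact: add_continuous.
  apply: cvgM; last by under eq_fun do rewrite !mxE; exact: qv.
  by apply: cvgMr_tmp; under eq_fun do rewrite !mxE; exact: qv.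
by apply: (cvgr_to_ge wv); apply: nearW => m; exact: Arat.
Qed.

Context {d : measure_display} {T : measurableType d}.
Variable lam : {finite_measure set T -> \bar R}.

Lemma mx_density_measurable m n (nu : mxcharge R T m n) :
  mx_dominated nu lam -> mx_measurable (mx_density nu lam).
Proof.
move=> dom i j; under eq_fun do rewrite mxE.
exact: measurableT_comp.
Qed.

Lemma mx_density_EFin m n (nu : mxcharge R T m n) i j : mx_dominated nu lam ->
  (fun x => (mx_density nu lam x i j)%:E) = Radon_Nikodym (nu i j) lam.
Proof.
move=> dom; apply/funext => x.
by rewrite mxE fineK// (Radon_Nikodym_fin_num _ (dom i j)).
Qed.

Lemma mx_density_integrable m n (nu : mxcharge R T m n) i j :
  mx_dominated nu lam ->
  lam.-integrable setT (fun x => (mx_density nu lam x i j)%:E).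
Proof.
by move=> dom; rewrite mx_density_EFin//; exact: Radon_Nikodym_integrable (dom i j).
Qed.

Lemma mx_density_integral m n (nu : mxcharge R T m n) i j A :
  mx_dominated nu lam -> measurable A ->
  nu i j A = (\int[lam]_(x in A) (mx_density nu lam x i j)%:E)%E.
Proof.
move=> dom mA; rewrite mx_density_EFin//.
exact: Radon_Nikodym_integral (dom i j) mA.
Qed.

Section ae.
Context {n : nat}.
Variable nu : mxcharge R T n n.
Hypothesis dom : mx_dominated nu lam.
Hypothesis pnu : forall A, measurable A -> psd (Defs.mx_val nu A).

Let dens := mx_density nu lam.

Let dens_sym i j : {ae lam, forall x, dens x i j = dens x j i}.
Proof.
have : ae_eq lam setT (fun x => (dens x i j)%:E) (fun x => (dens x j i)%:E).
  apply: integral_ae_eq => //.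
  - exact: mx_density_integrable.
  - by have /measurable_int := mx_density_integrable j i dom.
  move=> A _ mA; rewrite -!mx_density_integral//.
  have [+ _] := pnu mA => /matrixP/(_ j i); rewrite !mxE => nuij.
  by rewrite -[nu i j A]fineK ?fin_num_measure// nuij fineK// fin_num_measure.
by apply: filterS => x /(_ I)[].
Qed.

Let dens_qform v : {ae lam, forall x, 0 <= qform v (dens x)}.
Proof.
pose q x := qform v (dens x).
have intq : lam.-integrable setT (EFin \o q).
  rewrite /q; rewrite (_ : _ \o _ = (fun x => \sum_j \sum_i
      (v 0 i * v 0 j)%:E * (dens x i j)%:E)%E); last first.
    apply/funext => x /=; rewrite qformE -sumEFin; apply: eq_bigr => j _.
    by rewrite -sumEFin; apply: eq_bigr => i _; rewrite -EFinM mulrAC.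
  apply: integrable_sum => // j _; apply: integrable_sum => // i _.
  by apply: integrableZl => //; exact: mx_density_integrable.
have intA A : measurable A -> (\int[lam]_(x in A) (q x)%:E)%E = (qform v (Defs.mx_val nu A))%:E.
  move=> mA; rewrite qformE -sumEFin.
  rewrite (eq_integral (fun x => \sum_j \sum_i
      (v 0 i * v 0 j)%:E * (dens x i j)%:E)%E); last first.
    move=> x _; rewrite /q qformE -sumEFin; apply: eq_bigr => j _.
    by rewrite -sumEFin; apply: eq_bigr => i _; rewrite -EFinM mulrAC.
  have intij i j : lam.-integrable A (fun x => (dens x i j)%:E).
    by apply: (integrableS measurableT) => //; exact: mx_density_integrable.
  rewrite integral_sum//; last first.
    by move=> j; apply: integrable_sum => // i _; exact: integrableZl.
  apply: eq_bigr => j _; rewrite -sumEFin integral_sum//; last first.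
    by move=> i; exact: integrableZl.
  apply: eq_bigr => i _; rewrite integralZl// -mx_density_integral// !mxE.
  by rewrite mulrAC [RHS]EFinM fineK// fin_num_measure.
(* The integral of [q] over this set is the form of the psd matrix [nu A], hence nonnegative,
   although [q] is negative there; so [A] is null. *)
pose A := [set x | q x < 0].
have mq : measurable_fun setT q.
  by apply/measurable_EFinP; exact: measurable_int intq.
have mA : measurable A.
  rewrite (_ : A = setT `&` [set x | (EFin \o q) x < 0%:E]%E); last first.
    by rewrite setTI; apply/seteqP; split=> x /=; rewrite lte_fin.
  by apply: emeasurable_fun_infty_o => //; exact: measurable_int intq.
have : ae_eq lam A (EFin \o q) (cst 0%E).
  apply/(ae_eq_integral_abs _ mA); first exact/measurable_EFinP/measurable_funTS.
  apply/eqP; rewrite eq_le; apply/andP; split; last exact: integral_ge0.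
  rewrite (eq_integral (fun x => - (q x)%:E)%E); last first.
    by move=> x /[!inE] qx; rewrite /= ltr0_norm.
  rewrite integralN; last first.
    exact: (integrable_add_def mA (integrableS measurableT mA (@subsetT _ _) intq)).
  by rewrite intA// -EFinN lee_fin oppr_le0; have [_] := pnu mA; exact.
apply: filterS => x /= qA; rewrite leNgt; apply/negP => qx.
by have [q0] := qA qx; move: qx; rewrite -/(q x) q0 ltxx.
Qed.

Lemma psd_density_ae :
  exists N, [/\ measurable N, lam N = 0%E & forall x, ~ N x -> psd (dens x)].
Proof.
have : {ae lam, forall x, psd (dens x)}.
  have h1 : {ae lam, forall x, forall ij : 'I_n * 'I_n,
      dens x ij.1 ij.2 = dens x ij.2 ij.1}.
    by apply: filter_forall => ij; exact: dens_sym.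
  (* Rational vectors are enumerated by their codes in [nat]; a number that codes no vector carries
     a trivial condition. *)
  have h2 : {ae lam, forall x, forall k : nat, if unpickle k is Some v then
      0 <= qform (map_mx ratr (v : 'rV[rat]_n)) (dens x) else true}.
    apply/ae_foralln => k; case: unpickle => [v|]; last exact: nearW.
    exact: dens_qform.
  apply: filterS2 h1 h2 => x h1 h2; apply: psd_rat.
    by apply/matrixP => i j; rewrite mxE (h1 (j, i)).
  by move=> v; have := h2 (pickle v); rewrite pickleK.
move=> [N [mN N0 NP]]; exists N; split=> // x Nx.
by apply: contrapT => px; apply: Nx; exact: NP.
Qed.

End ae.
End psd_density.

(** * The measure dt lam on the cylinder *)

Section time_measure.
Context {R : realType}.

(* [lebesgue_measure] lives on [measurableTypeR R]; the canonical measurable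
   structure of [R] has the same measurable sets but another display. *)
Definition time_measure (A : set R) : \bar R :=
  @lebesgue_measure R (A `&` `[0, 1]).

Let mI : @measurable _ (measurableTypeR R) (`[0, 1] : set R).
Proof. exact: measurable_itv. Qed.

Let time_measureE : time_measure = mrestr lebesgue_measure mI.
Proof. by []. Qed.

Let time_measure0 : time_measure set0 = 0%E.
Proof. by rewrite time_measureE measure0. Qed.

Let time_measure_ge0 A : (0 <= time_measure A)%E.
Proof. by rewrite time_measureE measure_ge0. Qed.

Let time_measure_sigma_additive : semi_sigma_additive time_measure.
Proof.
exact: (@measure_semi_sigma_additive _ (measurableTypeR R) R
  (mrestr lebesgue_measure mI)).
Qed.

HB.instance Definition _ := isMeasure.Build _ R R time_measure
  time_measure0 time_measure_ge0 time_measure_sigma_additive.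

Lemma time_measure01 : time_measure `[0, 1]%classic = 1%E.
Proof. by rewrite /time_measure setIid lebesgue_measure_itv/= lte01 sube0. Qed.

Let time_measure_fin : fin_num_fun time_measure.
Proof.
move=> A mA; rewrite ge0_fin_numE//; apply: (@le_lt_trans _ _ 1%E); last exact: ltry.
rewrite -time_measure01 /time_measure setIid le_measure// inE//.
exact: (@measurableI _ (measurableTypeR R)).
Qed.

HB.instance Definition _ := @Measure_isFinite.Build _ R R
  time_measure time_measure_fin.

Let idR : measurableTypeR R -> R := id.

Let midR : measurable_fun setT idR.
Proof. by move=> _ A mA; rewrite setTI. Qed.

(** The two measures belong to different measurable structures on [R]; the push-forward along the
    identity [idR] passes from one to the other. *)
Lemma time_integralE (f : R -> \bar R) :
  lebesgue_measure.-integrable (`[0, 1]%classic : set R) f ->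
  (\int[time_measure]_(x in `[0%R, 1%R]) f x =
   \int[lebesgue_measure]_(x in `[0%R, 1%R]) f x)%E.
Proof.
move=> intf; rewrite (@eq_measure_integral _ _ _ _ (pushforward lebesgue_measure idR)).
  have mf : measurable_fun (`[0, 1] : set R) f.
    by move: (measurable_int _ intf).
  rewrite integral_mkcond integral_pushforward//.
  - by rewrite [RHS]integral_mkcond.
  - exact/(measurable_restrictT f).
  - exact: (integrable_mkcond _ _).1.
by move=> A mA AI; exact: (congr1 lebesgue_measure (setIidl AI)).
Qed.

End time_measure.

Section cylinder_measure.
Context {d : measure_display} {T : measurableType d} {R : realType}.
Variable lam : {finite_measure set T -> \bar R}.

Definition cylinder_measure : set (R * T)%type -> \bar R := (time_measure \x lam)%E.

HB.instance Definition _ := Measure.on cylinder_measure.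

Let cylinder_measure_fin : fin_num_fun cylinder_measure.
Proof.
move=> A mA; rewrite ge0_fin_numE//.
apply: (@le_lt_trans _ _ (cylinder_measure setT)).
  by rewrite le_measure// inE.
rewrite -setXTT [ltLHS]product_measure1E//.
by rewrite lte_mul_pinfty// ?ltey_eq ?fin_num_measure.
Qed.

HB.instance Definition _ := @Measure_isFinite.Build _ (R * T)%type R
  cylinder_measure cylinder_measure_fin.

End cylinder_measure.

Section cylinder_integrals.
Context {d : measure_display} {T : measurableType d} {R : realType}.
Variable lam : {finite_measure set T -> \bar R}.
Variable Omega : set T.
Hypothesis mOmega : measurable Omega.
Local Open Scope ereal_scope.

Let K : set (R * T)%type := `[0%R, 1%R]%classic `*` Omega.

Let mI : measurable (`[0%R, 1%R]%classic : set R).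
Proof. exact: measurable_itv. Qed.

Lemma measurable_cylinder : measurable K.
Proof. exact: measurableX. Qed.

Lemma cylinder_tonelli (U : T -> \bar R) : measurable_fun setT U ->
  (forall x, 0 <= U x) ->
  \int[cylinder_measure lam]_(z in K) U z.2 = \int[lam]_(x in Omega) U x.
Proof.
move=> mU U0; rewrite integral_mkcond.
rewrite [LHS](fubini_tonelli2 (m1 := time_measure) (m2 := lam)); last 2 first.
- apply/(measurable_restrictT (fun z => U z.2) measurable_cylinder).
  apply: measurable_funTS.
  exact: measurableT_comp.
- by apply: erestrict_ge0.
rewrite [RHS]integral_mkcond; apply: eq_integral => x _.
rewrite /fubini_G /patch; case: ifPn => xO.
  rewrite (eq_integral (fun t => U x * (\1_(`[0%R, 1%R]%classic : set R) t)%:E)).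
    rewrite ge0_integralZl//; last exact/measurable_EFinP/measurable_indic.
      by rewrite integral_indic// setIT [X in _ * X](@time_measure01 R) mule1.
  move=> t _; rewrite indicE in_setX xO andbT/=.
  by case: (t \in _); rewrite ?mule1 ?mule0.
apply: integral0_eq => t _; rewrite in_setX (negbTE xO) andbF//.
Qed.

Lemma cylinder_fubini (f : R * T -> \bar R) :
  (cylinder_measure lam).-integrable K f ->
  \int[cylinder_measure lam]_(z in K) f z =
  \int[lam]_(x in Omega) \int[time_measure]_(t in `[0%R, 1%R]) f (t, x).
Proof.
move=> intf; rewrite integral_mkcond.
have intfK : (cylinder_measure lam).-integrable setT (f \_ K).
  exact/(integrable_mkcond f measurable_cylinder).
rewrite -[LHS](integral21_prod_meas1 (m1 := time_measure) (m2 := lam))//.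
rewrite [RHS]integral_mkcond; apply: eq_integral => x _.
rewrite /fubini_G [RHS]/patch; case: ifPn => xO.
  rewrite [RHS]integral_mkcond; apply: eq_integral => t _.
  by rewrite /patch in_setX xO andbT.
by apply: integral0_eq => t _; rewrite /patch in_setX (negbTE xO) andbF.
Qed.

Lemma cylinder_integrable (p : R -> R) (f : T -> R) (M : R) :
  measurable_fun setT p -> (forall t, `[0%R, 1%R]%classic t -> `|p t| <= M)%R ->
  lam.-integrable setT (EFin \o f) ->
  (cylinder_measure lam).-integrable setT
    (fun z => (\1_K z * (p z.1 * f z.2))%:E).
Proof.
move=> mp pM intf; have mf : measurable_fun setT f.
  by apply/measurable_EFinP; exact: measurable_int intf.
have mg : measurable_fun setT (fun z : R * T => \1_K z * (p z.1 * f z.2))%R.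
  apply: measurable_funM; first by apply: measurable_indic; exact: measurable_cylinder.
  by apply: measurable_funM; exact: measurableT_comp.
apply/integrableP; split; first exact/measurable_EFinP.
have -> : \int[cylinder_measure lam]_z `|(\1_K z * (p z.1 * f z.2))%:E| =
    \int[cylinder_measure lam]_(z in K) `|(p z.1 * f z.2)%:E|.
  rewrite [RHS]integral_mkcond; apply: eq_integral => z _.
  by rewrite /patch indicE; case: (z \in K); rewrite ?mul1r// mul0r abse0.
apply: (@le_lt_trans _ _
    (\int[cylinder_measure lam]_(z in K) (`|M|%:E * `|f z.2|%:E))).
  apply: ge0_le_integral_nonmeasurable => // -[t x] [/= It _].
  rewrite normrM EFinM lee_wpmul2r ?lee_fin//.
  exact: le_trans (pM _ It) (ler_norm _).
rewrite (cylinder_tonelli (U := fun x => `|M|%:E * `|f x|%:E)); last 2 first.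
- apply: emeasurable_funM => //; apply/measurable_EFinP.
  exact: (measurableT_comp (@normr_measurable R setT)).
- by move=> x; rewrite mule_ge0 ?lee_fin.
rewrite ge0_integralZl//; last first.
  apply/measurable_EFinP/measurable_funTS.
  exact: (measurableT_comp (@normr_measurable R setT)).
apply: lte_mul_pinfty => //.
by have /integrableP[_] := integrableS measurableT mOmega (@subsetT _ _) intf.
Qed.

End cylinder_integrals.

(** * Absolute continuity and the total variation *)

Section total_variation_theory.
Context {R : realType} {d : measure_display} {T : measurableType d} {I : finType}.
Variable nu : I -> {charge set T -> \bar R}.
Local Open Scope ereal_scope.

Lemma dominates_tvar i : nu i `<< tvar nu.
Proof.
apply/null_content_dominatesP => A mA tA.
have v0 j : 0 <= charge_variation (hahnP (nu j)) A by exact: measure_ge0.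
have vi : charge_variation (hahnP (nu i)) A = 0.
  apply/eqP; rewrite eq_le v0 andbT; move: tA => <-.
  rewrite [leRHS](_ : _ = \sum_j charge_variation (hahnP (nu j)) A)//.
  by rewrite (bigD1 i)//= leeDl// sume_ge0.
apply/eqP; rewrite -abse_eq0 eq_le abse_ge0 andbT -[leRHS]vi.
exact: abse_charge_variation.
Qed.

Lemma tvar_dominates (mu : {measure set T -> \bar R}) :
  (forall i, nu i `<< mu) -> tvar nu `<< mu.
Proof.
move=> numu; apply/null_content_dominatesP => A mA muA; rewrite /tvar big1// => i _.
have /(null_charge_dominatesP (hahnP (nu i))) := numu i.
exact.
Qed.

End total_variation_theory.

(** * Integrable matrix-valued maps *)

Section mx_integrable.
Context {R : realType} {d : measure_display} {T : measurableType d}.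
Variable lam : {finite_measure set T -> \bar R}.

Definition mx_integrable m n (F : T -> 'M[R]_(m, n)) :=
  forall i j, lam.-integrable setT (fun x => (F x i j)%:E).

Lemma mx_integrableD m n (F G : T -> 'M[R]_(m, n)) :
  mx_integrable F -> mx_integrable G -> mx_integrable (fun x => F x + G x).
Proof.
move=> iF iG i j; apply: eq_integrable (integrableD _ (iF i j) (iG i j)) => //.
by move=> x _; rewrite mxE EFinD.
Qed.

Lemma mx_integrableZ m n c (F : T -> 'M[R]_(m, n)) :
  mx_integrable F -> mx_integrable (fun x => c *: F x).
Proof.
move=> iF i j; apply: eq_integrable (integrableZl _ c (iF i j)) => //.
by move=> x _; rewrite mxE EFinM.
Qed.

(** Each product of entries is bounded by the sum of their squares. By symmetry the squares along a
    row of [A] and a column of [B] add up to diagonal entries of [A A] and [B B]. *)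
Lemma mx_integrable_mul n (A B : T -> 'M[R]_n) :
  (forall x, symmx (A x)) -> (forall x, symmx (B x)) ->
  mx_measurable A -> mx_measurable B ->
  mx_integrable (fun x => A x *m A x) -> mx_integrable (fun x => B x *m B x) ->
  mx_integrable (fun x => A x *m B x).
Proof.
move=> sA sB mA mB iA iB i j.
apply: (le_integrable measurableT _ _ (integrableD measurableT (iA i i) (iB j j))).
  by apply/measurable_EFinP; exact: mx_measurableM.
move=> x _; rewrite lee_fin /=; apply: (le_trans _ (ler_norm _)).
rewrite !mxE -big_split/= (le_trans (ler_norm_sum _ _ _))//.
apply: ler_sum => l _; rewrite -[in A x l i]sA -[in B x j l]sB !mxE normrM.
have := sqr_ge0 (`|A x i l| - `|B x l j|).
rewrite -!expr2 -[A x i l ^+ 2]real_normK ?num_real//.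
rewrite -[B x l j ^+ 2]real_normK ?num_real//.
have := normr_ge0 (A x i l); have := normr_ge0 (B x l j); nra.
Qed.

End mx_integrable.

(** * The interpolating path and its action *)

Section sqrt_path.
Context {R : realType} {d : measure_display} {T : measurableType d}.
Variable lam : {finite_measure set T -> \bar R}.
Variables (Omega : set T) (n k : nat) (S0 S1 : T -> 'M[R]_n).
Hypothesis mOmega : measurable Omega.
Hypotheses (sS0 : forall x, symmx (S0 x)) (sS1 : forall x, symmx (S1 x)).
Hypotheses (mS0 : mx_measurable S0) (mS1 : mx_measurable S1).
Hypothesis iS0 : mx_integrable lam (fun x => S0 x *m S0 x).
Hypothesis iS1 : mx_integrable lam (fun x => S1 x *m S1 x).

Let K : set (R * T)%type := `[0%R, 1%R]%classic `*` Omega.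
Let rho := cylinder_measure lam.

Definition sqrt_path (z : R * T) : 'M[R]_n :=
  (1 - z.1) *: S0 z.2 + z.1 *: S1 z.2.

Definition sqrt_diff (x : T) : 'M[R]_n := S1 x - S0 x.

Lemma sqrt_path_sqrE z : sqrt_path z *m sqrt_path z =
  (1 - z.1) ^+ 2 *: (S0 z.2 *m S0 z.2) +
  ((1 - z.1) * z.1) *: (S0 z.2 *m S1 z.2 + S1 z.2 *m S0 z.2) +
  z.1 ^+ 2 *: (S1 z.2 *m S1 z.2).
Proof.
rewrite /sqrt_path mulmxDl !mulmxDr -!(scalemxAl, scalemxAr) !scalerA.
rewrite scalerDr -!expr2 [z.1 * (1 - z.1)]mulrC.
by rewrite -!addrA.
Qed.

Lemma sqrt_path_mulE z : 2 *: (sqrt_path z *m sqrt_diff z.2) =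
  (2 * (1 - z.1)) *: (S0 z.2 *m sqrt_diff z.2) +
  (2 * z.1) *: (S1 z.2 *m sqrt_diff z.2).
Proof. by rewrite /sqrt_path mulmxDl -!scalemxAl scalerDr !scalerA. Qed.

Let sD x : symmx (sqrt_diff x).
Proof. by rewrite /symmx /sqrt_diff linearB/= sS0 sS1. Qed.

Let mD : mx_measurable sqrt_diff.
Proof. by apply: mx_measurableD => //; exact: mx_measurableN. Qed.

Let iS01 : mx_integrable lam (fun x => S0 x *m S1 x).
Proof. exact: mx_integrable_mul. Qed.

Let iS10 : mx_integrable lam (fun x => S1 x *m S0 x).
Proof. exact: mx_integrable_mul. Qed.

Lemma sqrt_diff_integrable : mx_integrable lam (fun x => sqrt_diff x *m sqrt_diff x).
Proof.
have h : mx_integrable lam (fun x => (S1 x *m S1 x + S0 x *m S0 x) +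
    (-1) *: (S1 x *m S0 x + S0 x *m S1 x)).
  by apply: mx_integrableD; [|apply: mx_integrableZ]; exact: mx_integrableD.
move=> i j; apply: eq_integrable (h i j) => // x _; congr EFin.
rewrite /sqrt_diff mulmxBl !mulmxBr.
move: (S1 x *m S1 x) (S1 x *m S0 x) (S0 x *m S1 x) (S0 x *m S0 x) => a b c e.
by rewrite !mxE; ring.
Qed.

Let iS0D : mx_integrable lam (fun x => S0 x *m sqrt_diff x).
Proof. by apply: mx_integrable_mul => //; exact: sqrt_diff_integrable. Qed.

Let iS1D : mx_integrable lam (fun x => S1 x *m sqrt_diff x).
Proof. by apply: mx_integrable_mul => //; exact: sqrt_diff_integrable. Qed.

Lemma path_G_integrable i j :
  rho.-integrable setT (fun z => (\1_K z * (sqrt_path z *m sqrt_path z) i j)%:E).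
Proof.
have mX : measurable_fun setT (fun t : R => t) by exact: measurable_id.
have m1X : measurable_fun setT (fun t : R => 1 - t) by exact: measurable_funB.
have b01 (p : R -> R) : (forall t, 0 <= t -> t <= 1 -> 0 <= p t <= 1) ->
    forall t, `[0%R, 1%R]%classic t -> `|p t| <= 1.
  move=> p01 t; rewrite /= in_itv/= => /andP[t0 t1].
  by have /andP[? ?] := p01 _ t0 t1; rewrite ger0_norm.
have i1 : rho.-integrable setT (fun z =>
    (\1_K z * ((1 - z.1) ^+ 2 * (S0 z.2 *m S0 z.2) i j))%:E).
  apply: (cylinder_integrable mOmega (p := fun t => (1 - t) ^+ 2) (M := 1)
    (f := fun x => (S0 x *m S0 x) i j)).
  - exact: measurable_funX.
  - by apply: b01 => t t0 t1; apply/andP; split; nra.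
  - exact: (iS0 i j).
have i2 : rho.-integrable setT (fun z => (\1_K z * ((1 - z.1) * z.1 *
    (S0 z.2 *m S1 z.2 + S1 z.2 *m S0 z.2) i j))%:E).
  apply: (cylinder_integrable mOmega (p := fun t => (1 - t) * t) (M := 1)
    (f := fun x => (S0 x *m S1 x + S1 x *m S0 x) i j)).
  - exact: measurable_funM.
  - by apply: b01 => t t0 t1; apply/andP; split; nra.
  - exact: (mx_integrableD iS01 iS10 i j).
have i3 : rho.-integrable setT (fun z =>
    (\1_K z * (z.1 ^+ 2 * (S1 z.2 *m S1 z.2) i j))%:E).
  apply: (cylinder_integrable mOmega (p := fun t => t ^+ 2) (M := 1)
    (f := fun x => (S1 x *m S1 x) i j)).
  - exact: measurable_funX.
  - by apply: b01 => t t0 t1; apply/andP; split; nra.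
  - exact: (iS1 i j).
have i12 := integrableD measurableT i1 i2.
apply: eq_integrable (integrableD measurableT i12 i3) => // z _.
rewrite /= -!EFinD sqrt_path_sqrE -!mulrDr; congr (_ * _)%:E.
by move: (S0 _ *m S0 _) (S0 _ *m S1 _ + _) (S1 _ *m S1 _) => a b c; rewrite !mxE.
Qed.

Lemma path_R_integrable i j :
  rho.-integrable setT
    (fun z => (\1_K z * (2 *: (sqrt_path z *m sqrt_diff z.2)) i j)%:E).
Proof.
have mX : measurable_fun setT (fun t : R => 2 * t) by exact: measurable_funM.
have m1X : measurable_fun setT (fun t : R => 2 * (1 - t)).
  by apply: measurable_funM => //; exact: measurable_funB.
have i1 : rho.-integrable setT (fun z =>
    (\1_K z * (2 * (1 - z.1) * (S0 z.2 *m sqrt_diff z.2) i j))%:E).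
  apply: (cylinder_integrable mOmega (p := fun t => 2 * (1 - t)) (M := 2)
    (f := fun x => (S0 x *m sqrt_diff x) i j)) => //.
    by move=> t; rewrite /= in_itv/= => /andP[t0 t1]; rewrite ger0_norm; lra.
  exact: (iS0D i j).
have i2 : rho.-integrable setT (fun z =>
    (\1_K z * (2 * z.1 * (S1 z.2 *m sqrt_diff z.2) i j))%:E).
  apply: (cylinder_integrable mOmega (p := fun t => 2 * t) (M := 2)
    (f := fun x => (S1 x *m sqrt_diff x) i j)) => //.
    by move=> t; rewrite /= in_itv/= => /andP[t0 t1]; rewrite ger0_norm; lra.
  exact: (iS1D i j).
apply: eq_integrable (integrableD measurableT i1 i2) => // z _.
rewrite /= -!EFinD sqrt_path_mulE -!mulrDr; congr (_ * _)%:E.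
by move: (S0 _ *m _) (S1 _ *m _) => a b; rewrite !mxE.
Qed.

(** The charges are defined on the whole product space; the indicator [\1_K] in their densities
    confines them to the cylinder. *)
Definition path_measure : xmeasure R (R * T)%type n k :=
  XMeasure (fun i j => induced_charge (path_G_integrable i j))
    (fun _ _ => czero) (fun i j => induced_charge (path_R_integrable i j)).

Lemma path_measure_on : xmeasure_on K path_measure.
Proof.
split.
- move=> i j A mA AK; apply: integral0_eq => z Az; rewrite indicE.
  case: (boolP (z \in K)) => [/set_mem Kz|_]; last by rewrite mul0r.
  by have : (A `&` K) z by []; rewrite AK.
- by [].
- move=> i j A mA AK; apply: integral0_eq => z Az; rewrite indicE.
  case: (boolP (z \in K)) => [/set_mem Kz|_]; last by rewrite mul0r.
  by have : (A `&` K) z by []; rewrite AK.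
- move=> A mA; apply/matrixP => i j; rewrite !mxE; congr fine.
  apply: eq_integral => z _; congr (_ * _)%:E.
  have [+ _] : psd (sqrt_path z *m sqrt_path z).
    by apply: psd_sqr; rewrite /symmx /sqrt_path !linearD !linearZ/= sS0 sS1.
  by move=> /matrixP/(_ i j); rewrite mxE.
Qed.

(** The densities relative to [tau] are known almost everywhere on [H > 0] as quotients by [H].
    There [Jfun_bound] applies with [h = H], and its bound does not depend on time, so integrating
    over the unit time interval leaves an integral over [Omega]. *)
Lemma path_action_le (L1 : 'M[R]_k) (L2 : 'M[R]_n) :
  (action L1 L2 K path_measure <=
   \int[lam]_(x in Omega)
     (2 * frob (invmx L2) ^+ 2 * frob (sqrt_diff x) ^+ 2)%:E)%E.
Proof.
pose tau : {finite_measure set (R * T)%type -> \bar R} :=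
  tvar (xcoord path_measure).
pose H := Radon_Nikodym_SigmaFinite.f tau rho.
have Gdom i j : xG path_measure i j `<< rho.
  exact: (integral_charge_dominates (path_G_integrable i j)).
have Rdom i j : xR path_measure i j `<< rho.
  exact: (integral_charge_dominates (path_R_integrable i j)).
have qdom i j : xq path_measure i j `<< rho.
  by apply/null_content_dominatesP.
have taurho : tau `<< rho.
  apply: tvar_dominates => c; case: c => [[[i j]|[i j]]|[i j]] /=.
  - exact: Gdom.
  - exact: qdom.
  - exact: Rdom.
have Gtau i j : xG path_measure i j `<< tau.
  exact: (@dominates_tvar _ _ _ _ (xcoord path_measure) (inl (inl (i, j)))).
have qtau i j : xq path_measure i j `<< tau.
  exact: (@dominates_tvar _ _ _ _ (xcoord path_measure) (inl (inr (i, j)))).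
have Rtau i j : xR path_measure i j `<< tau.
  exact: (@dominates_tvar _ _ _ _ (xcoord path_measure) (inr (i, j))).
have aeG : {ae rho, forall z, forall ij : 'I_n * 'I_n, (0 < H z)%E ->
    mx_density (xG path_measure) tau z ij.1 ij.2 =
    (fine (H z))^-1 * (\1_K z * (sqrt_path z *m sqrt_path z) ij.1 ij.2)}.
  apply: filter_forall => -[i j] /=.
  have := Radon_Nikodym_quotient (path_G_integrable i j) _ (Gtau i j) taurho.
  by move=> /(_ (fun _ _ => erefl)); apply: filterS => z h Hz; rewrite mxE h.
have aeR : {ae rho, forall z, forall ij : 'I_n * 'I_n, (0 < H z)%E ->
    mx_density (xR path_measure) tau z ij.1 ij.2 =
    (fine (H z))^-1 * (\1_K z * (2 *: (sqrt_path z *m sqrt_diff z.2)) ij.1 ij.2)}.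
  apply: filter_forall => -[i j] /=.
  have := Radon_Nikodym_quotient (path_R_integrable i j) _ (Rtau i j) taurho.
  by move=> /(_ (fun _ _ => erefl)); apply: filterS => z h Hz; rewrite mxE h.
have aeq : {ae rho, forall z, forall ij : 'I_n * 'I_k, (0 < H z)%E ->
    mx_density (xq path_measure) tau z ij.1 ij.2 = 0}.
  apply: filter_forall => -[i j] /=.
  have i0 : rho.-integrable setT (EFin \o (fun=> 0)) by exact: integrable0.
  have := Radon_Nikodym_quotient i0 _ (qtau i j) taurho.
  have q0 (A : set (R * T)%type) : measurable A ->
      xq path_measure i j A = (\int[rho]_(x in A) 0%:E)%E.
    by rewrite integral0_eq.
  by move=> /(_ q0); apply: filterS => z h Hz; rewrite mxE h// mulr0.
have [N [mN N0 NP]] : {ae rho, forall z, K z -> (0 < H z)%E ->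
   [/\ mx_density (xG path_measure) tau z =
         (fine (H z))^-1 *: (sqrt_path z *m sqrt_path z),
       mx_density (xq path_measure) tau z = 0 &
       mx_density (xR path_measure) tau z =
         (fine (H z))^-1 *: (2 *: (sqrt_path z *m sqrt_diff z.2))]}.
  move: aeG aeR aeq; apply: filterS3 => z hG hR hq Kz Hz.
  have K1 : \1_K z = 1 :> R by rewrite indicE mem_set.
  split; apply/matrixP => i j.
  - by rewrite (hG (i, j))//= K1 mul1r [RHS]mxE.
  - by rewrite (hq (i, j))//= mxE.
  - by rewrite (hR (i, j))//= K1 mul1r [RHS]mxE.
pose U x := 2 * frob (invmx L2) ^+ 2 * frob (sqrt_diff x) ^+ 2.
have U0 x : 0 <= U x.
  by apply: mulr_ge0; [apply: mulr_ge0|]; rewrite ?sqr_ge0.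
have mU : measurable_fun setT U.
  apply: measurable_funM; first exact: measurable_cst.
  rewrite (_ : (fun x => _) = fun x => mxdot (sqrt_diff x) (sqrt_diff x)); last first.
    by apply/funext => x; rewrite frob_sqr.
  under eq_fun do rewrite mxdotE.
  by apply: measurable_sum => j; apply: measurable_sum => i; exact: measurable_funM.
rewrite -(cylinder_tonelli lam mOmega (U := fun x => (U x)%:E)); last 2 first.
- exact/measurable_EFinP.
- by move=> x; rewrite lee_fin.
apply: (@integral_dominated_measure_le _ _ _ rho tau K _ (fun z => U z.2) N) => //.
- exact: measurable_cylinder.
- exact: measurableT_comp.
- by move=> z _; exact: Jfun_ge0.
- by exists N; split.
- move=> z Kz Nz Hz; have /contrapT/(_ Kz Hz)[-> -> ->] := contra_not (@NP z) Nz.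
  apply: Jfun_bound; first by rewrite /symmx /sqrt_path !linearD !linearZ/= sS0 sS1.
  by rewrite fine_gt0// Hz ltey_eq Radon_Nikodym_SigmaFinite.f_fin_num.
Qed.

End sqrt_path.

(** * Domains and the fundamental theorem of calculus *)

Section borel_product.
Context {R : realType} {d : nat}.

Lemma open_measurable_rV (A : set 'rV[R]_d) : open A -> measurable A.
Proof. by move=> oA; apply: sub_gen_smallest. Qed.

Lemma rat_ball (x : R) (e : R) : 0 < e -> exists q : rat, ball (ratr q : R) e x.
Proof.
move=> e0; have xe : x - e < x + e by lra.
have [q] := rat_in_itvoo xe.
rewrite in_itv/= => /andP[q1 q2]; exists q.
by rewrite /ball/= ltr_norml; apply/andP; split; lra.
Qed.

Lemma rat_ball_rV (x : 'rV[R]_d) (e : R) : 0 < e ->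
  exists q : 'rV[rat]_d, ball (map_mx ratr q : 'rV[R]_d) e x.
Proof.
move=> e0; have /choice[q qx] : forall i, exists q : rat, ball (ratr q : R) e (x 0 i).
  by move=> i; exact: rat_ball.
exists (\row_i q i); split=> // i j; rewrite !mxE ord1; exact: qx.
Qed.

Let box (c : rat * 'rV[rat]_d * nat) : set (R * 'rV[R]_d) :=
  ball (ratr c.1.1 : R) c.2.+1%:R^-1 `*` ball (map_mx ratr c.1.2 : 'rV[R]_d) c.2.+1%:R^-1.

(* Every open set is a countable union of boxes with rational centers. *)
Lemma open_measurable_prod (A : set (R * 'rV[R]_d)) : open A -> measurable A.
Proof.
move=> oA; pose F m : set (R * 'rV[R]_d) :=
  if unpickle m is Some c then if pselect (box c `<=` A) then box c else set0
  else set0.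
have -> : A = \bigcup_m F m.
  apply/seteqP; split=> [z Az|z [m _]]; last first.
    by rewrite /F; case: unpickle => // c; case: pselect => // cA /cA.
  have /nbhs_ballP[e /= e0 eA] : nbhs z A by exact: open_nbhs_nbhs.
  (* Points of a box containing [z] lie within two radii of [z], so a radius below [e / 2] keeps the
     box in the [e]-ball. *)
  have [m _ me] := near_infty_natSinv_lt (PosNum (divr_gt0 e0 (ltr0Sn R 1))).
  have {}me : m.+1%:R^-1 < e / 2 := me m (leqnn m).
  have mme : m.+1%:R^-1 + m.+1%:R^-1 <= e by rewrite [leRHS]splitr lerD// ltW.
  have m0 : 0 < m.+1%:R^-1 :> R by rewrite invr_gt0.
  have [q qz] := rat_ball z.1 m0; have [r rz] := rat_ball_rV z.2 m0.
  have FE : F (pickle (q, r, m)) =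
      if pselect (box (q, r, m) `<=` A) then box (q, r, m) else set0.
    by rewrite /F pickleK.
  exists (pickle (q, r, m)); first exact: I.
  rewrite FE; case: pselect => [bA|[]]; first by split.
  move=> y [qy ry]; apply: eA; split => /=.
    apply: (le_ball mme).
    exact: ball_triangle (ball_sym qz) qy.
  apply: (le_ball mme).
  exact: ball_triangle (ball_sym rz) ry.
apply: bigcup_measurable => m _; rewrite /F; case: unpickle => // c.
case: pselect => [bA|bA]; last exact: measurable0.
apply: measurableX; first exact: measurable_ball.
by apply: open_measurable_rV; exact: ball_open.
Qed.

Lemma within_continuous_measurable (Q : set (R * 'rV[R]_d)) (f : R * 'rV[R]_d -> R) :
  {within Q, continuous f} -> measurable_fun Q f.
Proof.
move=> cf mQ; apply: (measurability _ (RGenOInfty.measurableE R)) => //.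
move=> _ [_ [a ->] <-].
have /continuousP/(_ _ (@open_gt _ a))/open_subspaceP[V oV VQ] := cf.
rewrite [X in measurable X](_ : _ = V `&` Q); last first.
  by rewrite VQ setIC; apply/seteqP; split=> z /=; rewrite in_itv/= andbT.
by apply: measurableI => //; exact: open_measurable_prod.
Qed.

End borel_product.

Section smooth_domain_theory.
Context {R : realType} {d : nat}.
Variable Omega : set 'rV[R]_d.
Hypothesis hOmega : smooth_domain Omega.

Lemma smooth_domain_measurable : measurable Omega.
Proof.
have [cO _ _] := hOmega; rewrite -(setCK Omega); apply: measurableC.
apply: open_measurable_rV; apply: closed_openC.
by apply: compact_closed => //; exact: norm_hausdorff.
Qed.

Lemma compact_cylinder : compact (cylinder Omega).
Proof.
by have [cO _ _] := hOmega; apply: compact_setX => //; exact: segment_compact.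
Qed.

Lemma interior_cylinder t x : 0 < t < 1 -> Omega° x -> (cylinder Omega)° (t, x).
Proof.
move=> t01 Ox; exists (`]0, 1[%classic, Omega) => /=.
  split=> //; apply: open_nbhs_nbhs; split; first exact: itv_open.
  by rewrite /= in_itv.
move=> [s y] [/= s01 Oy]; split=> //=.
by apply: subset_itv_oo_cc s01.
Qed.

(* Near a boundary point, [rho] is negative at points displaced along [-+v]. *)
Lemma smooth_domain_closure x : Omega x -> closure Omega° x.
Proof.
move=> Ox; have [Oix|Oix] := pselect (Omega° x); first exact: subset_closure.
have [_ _ /(_ x Ox Oix)[U [rho [oU Ux sU [v v0] UO]]]] := hOmega.
have rhox : rho x <= 0 by exact/(UO x Ux).
have drho y : U y -> differentiable rho y by exact: (sU [::]).
pose c := 'D_v rho x.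
pose q h := h^-1 *: (rho (h *: v + x) - rho x).
have qc : q h @[h --> 0^'] --> c.
  by have /cvg_ex[l ql] := @diff_derivable _ _ _ _ _ v (drho _ Ux); rewrite /c /derive;
    move/cvg_lim : (ql) => ->.
(* The product with [c] states that the difference quotient has the sign of [c], whichever that
   is. *)
have qc0 : \forall h \near 0^', 0 < q h * c.
  have : q h * c @[h --> 0^'] --> c * c by apply: cvgMr_tmp.
  by move/cvgr_gt; apply; rewrite -expr2 exprn_even_gt0.
move=> B xB.
have Bh : \forall h \near (0 : R), B (h *: v + x) /\ U (h *: v + x).
  have ch : h *: v + x @[h --> (0 : R)] --> x.
    rewrite -[X in _ --> X]add0r -[X in X + x](scale0r v).
    by apply: cvgD; [exact: cvgZr_tmp|exact: cvg_cst].
  by apply: filterI; apply: ch => //; exact: open_nbhs_nbhs.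
move: qc0; rewrite near_withinE => qc0.
have /nbhs_ballP[e /= e0 eP] : nbhs (0 : R) [set h | (h != 0 -> 0 < q h * c) /\
    (B (h *: v + x) /\ U (h *: v + x))].
  by apply: filterS2 qc0 Bh => h hq hB; split.
(* A step against the sign of [c], so that [h * q h], the increment of [rho], is negative. *)
pose h := - Num.sg c * (e / 2).
have c0 : c != 0 by [].
have h0 : h != 0 by rewrite mulf_neq0 ?oppr_eq0 ?sgr_eq0// gt_eqF// divr_gt0.
have /eP[/(_ h0) qh [By Uy]] : ball 0 e h.
  rewrite /ball/= sub0r normrN normrM normrN normr_sg c0 mul1r ger0_norm; lra.
exists (h *: v + x); split=> //.
have rhoy : rho (h *: v + x) < 0.
  apply: lt_le_trans rhox; rewrite -subr_lt0.
  have -> : rho (h *: v + x) - rho x = h * q h by rewrite /q mulVKf.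
  move: (q h) qh => r qh; rewrite /h mulrAC !mulNr oppr_lt0 mulr_gt0 ?divr_gt0//.
  have [cp|cn|c00] := ltgtP 0 c.
  - by rewrite gtr0_sg// mul1r; move: qh; rewrite pmulr_lgt0.
  - by rewrite (ltr0_sg cn) mulN1r oppr_gt0; move: qh; rewrite (nmulr_lgt0 _ cn).
  - by move: c0; rewrite -c00 eqxx.
have cr : {for h *: v + x, continuous rho} by exact/differentiable_continuous/drho.
have n1 : nbhs (h *: v + x) [set y | rho y < 0].
  exact: (cr [set r | r < 0] (open_nbhs_nbhs (conj (@open_lt R 0) rhoy))).
have n2 : nbhs (h *: v + x) U by exact: open_nbhs_nbhs.
by apply: filterS2 n1 n2 => y /= ry Uy'; apply/(UO y Uy'); exact: ltW.
Qed.

Lemma smooth_domain_seq x : Omega x ->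
  exists u : nat -> 'rV[R]_d, (forall m, Omega° (u m)) /\ u m @[m --> \oo] --> x.
Proof.
move=> /smooth_domain_closure clx.
have /choice[u uP] : forall m : nat, exists y, Omega° y /\ ball x m.+1%:R^-1 y.
  move=> m; have [|y [Oy xy]] := clx (ball x m.+1%:R^-1); last by exists y.
  by apply: nbhsx_ballx; rewrite invr_gt0.
exists u; split=> [m|]; first by have [] := uP m.
apply/cvg_ballP => e e0; near=> m.
have [_] := uP m; apply: le_ball; apply: ltW.
near: m; exact: (near_infty_natSinv_lt (PosNum e0)).
Unshelve. all: end_near. Qed.

End smooth_domain_theory.

Section directional_derivatives.
Context {R : realType}.

Lemma is_derive_cvgP (V W : normedModType R) (f : V -> W) (z v : V) (D : W) :
  is_derive z v f D <->
  h^-1 *: (f (h *: v + z) - f z) @[h --> 0^'] --> D.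
Proof.
split=> [[df <-]|df]; first exact: df.
apply: DeriveDef; last exact/cvg_lim.
by apply/cvg_ex; exists D.
Qed.

Lemma is_derive_entry (V : normedModType R) m n (f : V -> 'M[R]_(m, n)) (z v : V)
    (D : 'M[R]_(m, n)) i j :
  is_derive z v f D -> is_derive z v (fun y => f y i j) (D i j).
Proof.
move=> /is_derive_cvgP df; apply/is_derive_cvgP.
have := cvg_comp _ _ df (@coord_continuous R m n i j D).
apply: cvg_trans; apply: near_eq_cvg; apply: nearW => h /=; rewrite !mxE//.
Qed.

Lemma is_derive_slice (V : normedModType R) (f : R * V -> R) (z : R * V) D :
  is_derive z (1, 0) f D -> is_derive z.1 1 (fun s => f (s, z.2)) D.
Proof.
move=> /is_derive_cvgP df; apply/is_derive_cvgP; apply: cvg_trans df.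
apply: near_eq_cvg; apply: nearW => h /=.
have -> : h *: (1, 0) + z = (h *: 1 + z.1, z.2) :> R * V.
  by congr pair; rewrite /= scaler0 add0r.
by rewrite -surjective_pairing.
Qed.

End directional_derivatives.

Section cylinder_FTC.
Context {R : realType} {d : nat}.
Variable Omega : set 'rV[R]_d.
Hypothesis hOmega : smooth_domain Omega.
Let Q := cylinder Omega.

Lemma within_cvg_seq (f : R * 'rV[R]_d -> R) (u : nat -> 'rV[R]_d) t x :
  {within Q, continuous f} -> 0 <= t <= 1 -> (forall m, Omega (u m)) -> Omega x ->
  u m @[m --> \oo] --> x -> f (t, u m) @[m --> \oo] --> f (t, x).
Proof.
move=> /subspace_continuousP cf t01 Ou Ox ux.
have Qtx : Q (t, x) by split=> //=; rewrite in_itv.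
apply: cvg_comp (cf _ Qtx) => A /= [[B C] [/= Bt Cx] BCA].
have uC : \forall m \near \oo, C (u m) by exact: ux.
apply: filterS uC => m Cum; apply: BCA => /=.
  by split=> //=; exact: (nbhs_singleton Bt).
by split=> //=; rewrite in_itv.
Qed.

Lemma within_continuous_slice (f : R * 'rV[R]_d -> R) x :
  {within Q, continuous f} -> Omega x ->
  {within `[0, 1], continuous (fun t => f (t, x))}.
Proof.
move=> /subspace_continuousP cf Ox; apply/subspace_continuousP => t It.
have Qtx : Q (t, x) by split.
apply: cvg_comp (cf _ Qtx) => A /= [[B C] [/= Bt Cx] BCA].
have : nbhs t B by []; apply: filterS => s Bs Is; apply: BCA => //=.
by split=> //=; exact: (nbhs_singleton Cx).
Qed.

Lemma within_bounded (f : R * 'rV[R]_d -> R) : {within Q, continuous f} ->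
  exists M, forall z, Q z -> `|f z| <= M.
Proof.
move=> cf; have := continuous_compact cf (compact_cylinder hOmega).
move=> /compact_bounded[M [_ /(_ (M + 1))]]; rewrite ltrDl ltr01 => /(_ isT) fM.
by exists (M + 1) => z Qz; apply: fM; exists z.
Qed.

Variables (f g : R * 'rV[R]_d -> R) (p p' : R -> R).
Hypothesis cf : {within Q, continuous f}.
Hypothesis cg : {within Q, continuous g}.
Hypothesis dfg : forall z, Q° z -> is_derive z (1, 0) f (g z).
Hypothesis dp : forall t : R, is_derive t 1 p (p' t).
Hypothesis cp' : continuous p'.

Let cp : continuous p.
Proof. by move=> t; apply/differentiable_continuous/derivable1_diffP; case: (dp t). Qed.

Let h x t := g (t, x) * p t + f (t, x) * p' t.

Let ch x : Omega x -> {within `[0, 1], continuous (h x)}.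
Proof.
move=> Ox t; apply: cvgD; apply: cvgM.
- exact: within_continuous_slice.
- exact: continuous_subspaceT.
- exact: within_continuous_slice.
- exact: continuous_subspaceT.
Qed.

Let ih x : Omega x -> lebesgue_measure.-integrable (`[0, 1]%classic : set R) (EFin \o h x).
Proof.
move=> Ox; apply: continuous_compact_integrable; first exact: segment_compact.
exact: ch.
Qed.

Let FTC_interior x : Omega° x ->
  (\int[lebesgue_measure]_(t in `[0%R, 1%R]) (h x t)%:E =
   (f (1, x) * p 1 - f (0, x) * p 0)%:E)%E.
Proof.
move=> Oix; have Ox : Omega x by exact: interior_subset.
have dF (t : R) : 0 < t < 1 -> is_derive t 1 (fun s => f (s, x) * p s) (h x t).
  move=> t01; have Qi : Q° (t, x) by exact: interior_cylinder.
  have d1 := is_derive_slice (dfg Qi).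
  have d2 := dp t.
  by apply: (is_derive_eq (is_deriveM d1 d2)); rewrite /h addrC; congr (_ + _);
    rewrite mulrC.
rewrite EFinB; apply: (@continuous_FTC2 R _ (fun s => f (s, x) * p s)) => //.
- exact: ch.
- have := within_continuous_slice cf Ox.
  move/(continuous_within_itvP _ ltr01) => [_ f0 f1]; split.
  + by move=> t; rewrite in_itv => /dF[].
  + apply: cvgM => //; apply: cvg_at_right_filter; exact: cp.
  + apply: cvgM => //; apply: cvg_at_left_filter; exact: cp.
- by move=> t; rewrite in_itv derive1E => /dF[].
Qed.

(** Test functions have derivatives only in the interior of the cylinder, while [lam] may charge the
    boundary of [Omega]. The identity therefore holds first on slices over interior points and
    reaches the others by dominated convergence, the continuous extensions being bounded on the
    compact cylinder. *)
Lemma cylinder_FTC x : Omega x ->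
  (\int[time_measure]_(t in `[0%R, 1%R]) (g (t, x) * p t + f (t, x) * p' t)%:E =
   (f (1, x) * p 1 - f (0, x) * p 0)%:E)%E.
Proof.
move=> Ox; rewrite time_integralE; last exact: ih.
have [u [Ou ux]] := smooth_domain_seq hOmega Ox.
have Ou' m : Omega (u m) by exact: (interior_subset (Ou m)).
have [Mf fM] := within_bounded cf; have [Mg gM] := within_bounded cg.
have bnd (q : R -> R) : continuous q ->
    exists M, forall t, 0 <= t <= 1 -> `|q t| <= M.
  move=> cq; have := continuous_compact (continuous_subspaceT cq) (@segment_compact R 0 1).
  move=> /compact_bounded[M [_ /(_ (M + 1))]]; rewrite ltrDl ltr01 => /(_ isT) qM.
  by exists (M + 1) => z Qz; apply: qM; exists z => //=; rewrite in_itv.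
have [Mp pM] := bnd _ cp; have [Mp' p'M] := bnd _ cp'.
have lim1 : (\int[lebesgue_measure]_(t in `[0%R, 1%R]) (h (u m) t)%:E)%E
    @[m --> \oo] --> (\int[lebesgue_measure]_(t in `[0%R, 1%R]) (h x t)%:E)%E.
  apply: (@dominated_cvg _ (measurableTypeR R) R lebesgue_measure _ _
    (fun m t => (h (u m) t)%:E) (fun t => (h x t)%:E) (fun=> (Mg * Mp + Mf * Mp')%:E)).
  - exact: measurable_itv.
  - by move=> m; exact: (measurable_int _ (ih (Ou' m))).
  - move=> t; rewrite /= in_itv/= => t01; apply: cvg_EFin; first exact: nearW.
    by apply: cvgD; apply: cvgMr_tmp; apply: within_cvg_seq.
  - by [].
  - apply: (continuous_compact_integrable (f := cst (Mg * Mp + Mf * Mp'))).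
      exact: segment_compact.
    by apply: continuous_subspaceT => ?; exact: cst_continuous.
  - move=> m t; rewrite /= in_itv/= => t01; rewrite lee_fin.
    have Qm : Q (t, u m) by split=> //=; rewrite in_itv.
    rewrite (le_trans (ler_normD _ _))// !normrM lerD// ler_pM//.
    + exact: gM.
    + exact: pM.
    + exact: fM.
    + exact: p'M.
have lim2 : (\int[lebesgue_measure]_(t in `[0%R, 1%R]) (h (u m) t)%:E)%E
    @[m --> \oo] --> (f (1, x) * p 1 - f (0, x) * p 0)%:E.
  under eq_fun do rewrite FTC_interior//.
  apply: cvg_EFin; first exact: nearW.
  by apply: cvgB; apply: cvgMr_tmp; apply: within_cvg_seq => //; rewrite ?lexx ?ler01.
exact: (cvg_unique (@ereal_hausdorff R) lim1 lim2).
Qed.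

End cylinder_FTC.

(** The Hahn decomposition is obtained by choice, so the Jordan parts of the zero charge are not 0
    by computation; they vanish because the zero measure dominates them. *)
Lemma int_charge_czero {R : realType} {d : measure_display} {T : measurableType d}
    (D : set T) (phi : T -> R) : int_charge (czero : {charge set T -> \bar R}) D phi = 0.
Proof.
have z (m : {measure set T -> \bar R}) : (forall A, measurable A -> m A = 0%E) ->
    \int[m]_(x in D) phi x = 0.
  move=> m0; rewrite /Rintegral (@eq_measure_integral _ _ _ _ mzero).
    by rewrite integral_measure_zero.
  by move=> A mA _; rewrite m0.
have z0 : (czero : {charge set T -> \bar R}) `<< (mzero : {measure set T -> \bar R}).
  exact/null_content_dominatesP.
rewrite /int_charge !z ?subrr// => A mA.
  by have /null_content_dominatesP := jordan_neg_dominates (hahnP czero) z0; exact.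
by have /null_content_dominatesP := jordan_pos_dominates (hahnP czero) z0; exact.
Qed.

(** * The continuity equation *)

Section path_continuity_equation.
Context {R : realType} {n k d : nat}.
Variable Omega : set 'rV[R]_d.
Hypothesis hOmega : smooth_domain Omega.
Variable lam : {finite_measure set 'rV[R]_d -> \bar R}.
Variables (S0 S1 : 'rV[R]_d -> 'M[R]_n).
Hypotheses (sS0 : forall x, symmx (S0 x)) (sS1 : forall x, symmx (S1 x)).
Hypotheses (mS0 : mx_measurable S0) (mS1 : mx_measurable S1).
Hypothesis iS0 : mx_integrable lam (fun x => S0 x *m S0 x).
Hypothesis iS1 : mx_integrable lam (fun x => S1 x *m S1 x).
Variables G0 G1 : mxcharge R 'rV[R]_d n n.
Hypothesis G0E : forall i j A, measurable A ->
  G0 i j A = (\int[lam]_(x in A) ((S0 x *m S0 x) i j)%:E)%E.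
Hypothesis G1E : forall i j A, measurable A ->
  G1 i j A = (\int[lam]_(x in A) ((S1 x *m S1 x) i j)%:E)%E.

Let mOmega := smooth_domain_measurable hOmega.
Let K := cylinder Omega.
Let rho := cylinder_measure lam.
Let mK : measurable K. Proof. exact: measurable_cylinder. Qed.
Let Gm z := sqrt_path S0 S1 z *m sqrt_path S0 S1 z.
Let Rm z := 2 *: (sqrt_path S0 S1 z *m sqrt_diff S0 S1 z.2).

Lemma is_derive_quadratic (a b c t : R) :
  is_derive t 1 (fun t => (1 - t) ^+ 2 * a + (1 - t) * t * b + t ^+ 2 * c)
    (- 2 * (1 - t) * a + (1 - 2 * t) * b + 2 * t * c).
Proof.
apply: is_derive_eq; rewrite /GRing.scale/=; ring.
Qed.

Section entry.
Variables (i j : 'I_n) (f g : R * 'rV[R]_d -> R).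
Hypotheses (cf : {within K, continuous f}) (cg : {within K, continuous g}).
Hypothesis dfg : forall z, K° z -> is_derive z (1, 0) f (g z).

(** Integration by parts in time for one entry of [Q_t^2], a quadratic polynomial in [t]. Its
    derivative is the mean of the [(i, j)] and [(j, i)] entries of [Rm], whence the factor
    [2^-1]. *)
Lemma path_entry :
  \int[rho]_(z in K) (\1_K z * Gm z i j * g z) +
  2^-1 * (\int[rho]_(z in K) (\1_K z * Rm z i j * f z) +
          \int[rho]_(z in K) (\1_K z * Rm z j i * f z)) =
  int_charge (G1 i j) Omega (fun x => f (1, x)) -
  int_charge (G0 i j) Omega (fun x => f (0, x)).
Proof.
have [Mf fM] := within_bounded hOmega cf.
have [Mg gM] := within_bounded hOmega cg.
have mf := within_continuous_measurable cf.
have mg := within_continuous_measurable cg.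
have iG := integrable_bounded_mul
  (path_G_integrable mOmega sS0 sS1 mS0 mS1 iS0 iS1 i j) mK mg gM.
have iR p q := integrable_bounded_mul
  (path_R_integrable mOmega sS0 sS1 mS0 mS1 iS0 iS1 p q) mK mf fM.
have mslice (s : R) : 0 <= s <= 1 -> measurable_fun Omega (fun x => f (s, x)).
  move=> s01; apply: (measurable_comp mK) mf _ => //.
    by move=> _ [x Ox <-]; split=> //=; rewrite in_itv.
  by apply: measurable_funTS; exact: measurable_pair1.
have bslice (s : R) : 0 <= s <= 1 -> forall x, Omega x -> `|f (s, x)| <= Mf.
  by move=> s01 x Ox; apply: fM; split=> //=; rewrite in_itv.
have s0 : 0 <= (0 : R) <= 1 by rewrite lexx ler01.
have s1 : 0 <= (1 : R) <= 1 by rewrite lexx ler01.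
rewrite (int_chargeE (iS1 i j) (G1E i j) mOmega (mslice _ s1) (bslice _ s1)).
rewrite (int_chargeE (iS0 i j) (G0E i j) mOmega (mslice _ s0) (bslice _ s0)).
have i1 := integrable_bounded_mul (iS1 i j) mOmega (mslice _ s1) (bslice _ s1).
have i0 := integrable_bounded_mul (iS0 i j) mOmega (mslice _ s0) (bslice _ s0).
rewrite -(RintegralB mOmega i1 i0).
pose W z := 2^-1 * (\1_K z * Rm z i j * f z + \1_K z * Rm z j i * f z).
have iRR : rho.-integrable K (EFin \o (fun z =>
    \1_K z * Rm z i j * f z + \1_K z * Rm z j i * f z)).
  exact: (integrableD mK (iR i j) (iR j i)).
have iW : rho.-integrable K (EFin \o W) by exact: (integrableZl mK _ iRR).
rewrite -(RintegralD mK (iR i j) (iR j i)) -(RintegralZl _ mK iRR).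
rewrite -(RintegralD mK iG iW) /Rintegral; congr fine.
have iGW := integrableD mK iG iW.
rewrite [LHS](cylinder_fubini mOmega iGW); apply: eq_integral => x /set_mem Ox.
pose a := (S0 x *m S0 x) i j; pose c := (S1 x *m S1 x) i j.
pose b := (S0 x *m S1 x + S1 x *m S0 x) i j.
pose p t := (1 - t) ^+ 2 * a + (1 - t) * t * b + t ^+ 2 * c.
pose p' t := - 2 * (1 - t) * a + (1 - 2 * t) * b + 2 * t * c.
have cp' : continuous p'.
  have cX : continuous (fun t : R => t) by move=> ?; exact: cvg_id.
  move=> t; apply: cvgD; [apply: cvgD|]; apply: cvgMr_tmp.
  - by apply: cvgMl_tmp; apply: cvgB; [exact: cvg_cst|exact: cX].
  - by apply: cvgB; [exact: cvg_cst|apply: cvgMl_tmp; exact: cX].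
  - by apply: cvgMl_tmp; exact: cX.
have := cylinder_FTC hOmega cf cg dfg (is_derive_quadratic a b c) cp' Ox.
have -> : f (1, x) * ((1 - 1) ^+ 2 * a + (1 - 1) * 1 * b + 1 ^+ 2 * c) -
    f (0, x) * ((1 - 0) ^+ 2 * a + (1 - 0) * 0 * b + 0 ^+ 2 * c) =
    c * f (1, x) - a * f (0, x) by ring.
move=> <-; apply: eq_integral => t /set_mem It.
have K1 : \1_K (t, x) = 1 :> R by rewrite indicE mem_set.
rewrite /= /W K1 !mul1r; congr EFin; congr (_ + _).
  rewrite mulrC /Gm sqrt_path_sqrE /=.
  by rewrite /a /b /c !mxE.
rewrite -mulrDl mulrA mulrC; congr (_ * _).
rewrite /Rm sqrt_path_mulE/= /sqrt_diff !mulmxBr.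
have tr A B : symmx A -> symmx B -> (A *m B) j i = (B *m A) i j :> R.
  move=> sA sB; have := congr1 (fun M : 'M[R]_n => M i j) (trmx_mul A B).
  by rewrite mxE sA sB.
have t00 := tr _ _ (sS0 x) (sS0 x); have t01 := tr _ _ (sS0 x) (sS1 x).
have t10 := tr _ _ (sS1 x) (sS0 x); have t11 := tr _ _ (sS1 x) (sS1 x).
move: t00 t01 t10 t11; rewrite /a /b /c.
move: (S0 x *m S0 x) (S0 x *m S1 x) (S1 x *m S0 x) (S1 x *m S1 x) => A B C E.
by move=> AE BE CE EE; rewrite !mxE AE BE CE EE; field.
Qed.

End entry.

Lemma path_measure_CE (D0 : {linear 'M[R]_n -> 'M[R]_(n, k)})
    (D : 'I_d -> {linear 'M[R]_n -> 'M[R]_(n, k)}) :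
  CE D0 D Omega G0 G1
    (path_measure k mOmega sS0 sS1 mS0 mS1 iS0 iS1).
Proof.
split; first exact: path_measure_on.
move=> Phi Phit Phix [sPhi cPhi cPhit _ dPhi].
have entry_continuous m p (F : R * 'rV[R]_d -> 'M[R]_(m, p)) a b :
    {within K, continuous F} -> {within K, continuous (fun z => F z a b)}.
  move=> /subspace_continuousP cF; apply/subspace_continuousP => z Kz.
  exact: (cvg_comp _ _ (cF z Kz) (@coord_continuous R m p a b (F z))).
have cf i j := entry_continuous _ _ _ i j cPhi.
have cg i j := entry_continuous _ _ _ i j cPhit.
have dfg i j z : K° z ->
    is_derive z (1, 0) (fun z => Phi z i j) (Phit z i j).
  by move=> /dPhi[dP _]; exact: is_derive_entry.
rewrite /int_mx -sumrB.
rewrite [X in _ + X + _]big1 ?addr0; last first.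
  by move=> i _; rewrite big1// => j _; rewrite int_charge_czero.
pose J i j := \int[rho]_(z in K) (\1_K z * Rm z i j * Phi z i j).
have RE i j : int_charge (xR (path_measure k mOmega sS0 sS1 mS0 mS1 iS0 iS1) i j)
    K (fun z => Phi z i j) = J i j.
  have [Mf fM] := within_bounded hOmega (cf i j).
  apply: (int_chargeE (f := fun z => \1_K z * Rm z i j)
    (path_R_integrable mOmega sS0 sS1 mS0 mS1 iS0 iS1 i j) _ mK _ fM) => //.
  exact: within_continuous_measurable.
have GE i j : int_charge (xG (path_measure k mOmega sS0 sS1 mS0 mS1 iS0 iS1) i j)
    K (fun z => Phit z i j) = \int[rho]_(z in K) (\1_K z * Gm z i j * Phit z i j).
  have [Mg gM] := within_bounded hOmega (cg i j).
  apply: (int_chargeE (f := fun z => \1_K z * Gm z i j)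
    (path_G_integrable mOmega sS0 sS1 mS0 mS1 iS0 iS1 i j) _ mK _ gM) => //.
  exact: within_continuous_measurable.
have symJ i j : \int[rho]_(z in K) (\1_K z * Rm z j i * Phi z i j) = J j i.
  apply: eq_Rintegral => z /set_mem Kz.
  by have /matrixP/(_ j i) := sPhi _ Kz; rewrite mxE => ->.
(* Symmetry of [Phi] makes the transposed entries of [Rm] pair with the same test function. Summed
   over all indices, [J i j] and [J j i] agree, so the sum can be symmetrized to match [path_entry]
   term by term. *)
transitivity (\sum_i \sum_j (\int[rho]_(z in K) (\1_K z * Gm z i j * Phit z i j) +
    2^-1 * (J i j + J j i))).
  rewrite (eq_bigr _ (fun i _ => eq_bigr _ (fun j _ => GE i j))).
  rewrite [X in _ + X = _](eq_bigr _ (fun i _ => eq_bigr _ (fun j _ => RE i j))).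
  under [RHS]eq_bigr do rewrite big_split/=.
  rewrite big_split/=; congr (_ + _).
  under [RHS]eq_bigr do rewrite -mulr_sumr big_split/=.
  rewrite -mulr_sumr big_split/= [X in _ = _ * (_ + X)]exchange_big/=.
  by field.
apply: eq_bigr => i _; rewrite -sumrB; apply: eq_bigr => j _.
by rewrite -(symJ i j); exact: (path_entry i j (cf i j) (cg i j) (dfg i j)).
Qed.

End path_continuity_equation.

(** * Square roots of the densities *)

Section root_density.
Context {R : realType} {d : measure_display} {T : measurableType d} {n : nat}.
Variable lam : {finite_measure set T -> \bar R}.

Variables (nu : mxcharge R T n n) (N : set T).
Hypothesis dom : mx_dominated nu lam.
Hypotheses (mN : measurable N) (lamN : lam N = 0%E).
Hypothesis pN : forall x, ~ N x -> psd (mx_density nu lam x).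

(** The density is psd only off the null set [N]; setting it to 0 on [N] makes it psd everywhere
    without changing any integral. *)
Definition psd_part (x : T) : 'M[R]_n := \1_(~` N) x *: mx_density nu lam x.

Lemma psd_part_out x : ~ N x -> psd_part x = mx_density nu lam x.
Proof. by move=> Nx; rewrite /psd_part indicE mem_set// scale1r. Qed.

Lemma psd_part_in x : N x -> psd_part x = 0.
Proof. by move=> Nx; rewrite /psd_part indicE memNset ?scale0r//; exact. Qed.

Lemma psd_partP x : psd (psd_part x).
Proof.
have [Nx|Nx] := pselect (N x); first by rewrite psd_part_in//; exact: psd0.
by rewrite psd_part_out//; exact: pN.
Qed.

Lemma psd_part_measurable : mx_measurable psd_part.
Proof.
apply: mx_measurableZ; last exact: mx_density_measurable.
exact/measurable_indic/measurableC.
Qed.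

Lemma psd_part_integrable : mx_integrable lam psd_part.
Proof.
move=> i j; apply: (le_integrable measurableT _ _ (mx_density_integrable i j dom)).
  by apply/measurable_EFinP; exact: psd_part_measurable.
move=> x _ /=; rewrite lee_fin mxE normrM ler_piMl// indicE.
by case: (_ \in _); rewrite ?normr1// normr0.
Qed.

Lemma psd_part_integral i j A : measurable A ->
  nu i j A = (\int[lam]_(x in A) (psd_part x i j)%:E)%E.
Proof.
move=> mA; rewrite (mx_density_integral i j dom mA); apply: ae_eq_integral => //.
- apply: measurable_funTS; apply: measurable_int.
  exact: (mx_density_integrable i j dom).
- by apply/measurable_EFinP/measurable_funTS; exact: psd_part_measurable.
exists N; split=> // x /= /not_implyP[_ xN]; apply: contrapT => Nx.
by apply: xN; rewrite psd_part_out.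
Qed.

Definition root_density (x : T) : 'M[R]_n := psd_sqrt (psd_part x).

Lemma root_density_sym x : symmx (root_density x).
Proof. by have [] := psd_sqrtP (psd_part x). Qed.

Lemma root_density_measurable : mx_measurable root_density.
Proof.
exact: mx_measurable_psd_sqrt psd_partP psd_part_measurable.
Qed.

Lemma root_density_sqr x : root_density x *m root_density x = psd_part x.
Proof. exact/psd_sqrt_sqr/psd_partP. Qed.

Lemma root_density_integrable :
  mx_integrable lam (fun x => root_density x *m root_density x).
Proof.
by move=> i j; under eq_fun do rewrite root_density_sqr; exact: psd_part_integrable.
Qed.

Lemma root_density_integral i j A : measurable A ->
  nu i j A = (\int[lam]_(x in A) ((root_density x *m root_density x) i j)%:E)%E.
Proof.
by move=> mA; under eq_integral do rewrite root_density_sqr; exact: psd_part_integral.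
Qed.

End root_density.

(** The admissible measures do not depend on [L1], nor does the total variation that the action
    integrates against, so the pointwise comparison of [Jfun] suffices. *)
Lemma WB2_le0 (R : realType) (n k d : nat) (L1 : 'M[R]_k) (L2 : 'M[R]_n)
    (Omega : set 'rV[R]_d)
    (D0 : {linear 'M[R]_n -> 'M[R]_(n, k)})
    (D : 'I_d -> {linear 'M[R]_n -> 'M[R]_(n, k)})
    (G0 G1 : mxcharge R 'rV[R]_d n n) :
  (WB2 D0 D Omega L1 L2 G0 G1 <= WB2 D0 D Omega 0 L2 G0 G1)%E.
Proof.
apply: le_ereal_inf_tmp => _ [mu muCE <-].
apply: (@le_trans _ _ (action L1 L2 (cylinder Omega) mu)).
  by apply: ereal_inf_lbound; exists mu.
apply: ge0_le_integral_nonmeasurable => z _; first exact: Jfun_ge0.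
exact: Jfun_le0.
Qed.

Theorem lemma3p9 (R : realType) (n k d : nat)
    (hn : (0 < n)%N) (hk : (0 < k)%N) (hd : (0 < d)%N)
    (L1 : 'M[R]_k) (L2 : 'M[R]_n) (hL1 : psd L1) (hL2 : posdef L2)
    (Omega : set 'rV[R]_d) (hOmega : smooth_domain Omega)
    (D0 : {linear 'M[R]_n -> 'M[R]_(n, k)})
    (D : 'I_d -> {linear 'M[R]_n -> 'M[R]_(n, k)})
    (hD : D0 1%:M = 0)
    (G0 G1 : mxcharge R 'rV[R]_d n n)
    (hG0 : psd_measure_on Omega G0) (hG1 : psd_measure_on Omega G1)
    (lam : {finite_measure set 'rV[R]_d -> \bar R})
    (hlam : supported_in Omega lam)
    (hG0lam : mx_dominated G0 lam) (hG1lam : mx_dominated G1 lam) :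
  (exists mu : xmeasure R (R * 'rV[R]_d)%type n k,
     [/\ CE D0 D Omega G0 G1 mu,
         forall i j A, measurable A -> xq mu i j A = 0%E &
         action L1 L2 (cylinder Omega) mu \is a fin_num]) /\
  (WB2 D0 D Omega L1 L2 G0 G1 <= WB2 D0 D Omega 0 L2 G0 G1)%E /\
  (WB2 D0 D Omega 0 L2 G0 G1 <=
     (2 * frob (invmx L2) ^+ 2)%:E *
     \int[lam]_(x in Omega)
       ((frob (psd_sqrt (mx_density G1 lam x) - psd_sqrt (mx_density G0 lam x))
         ^+ 2)%:E))%E.
Proof.
have [N0 [mN0 lamN0 pN0]] := psd_density_ae hG0lam hG0.2.
have [N1 [mN1 lamN1 pN1]] := psd_density_ae hG1lam hG1.2.
pose N := N0 `|` N1; have mN : measurable N by exact: measurableU.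
have lamN : lam N = 0%E by rewrite measureU0.
have {}pN0 x : ~ N x -> psd (mx_density G0 lam x).
  by move=> Nx; apply: pN0 => N0x; apply: Nx; left.
have {}pN1 x : ~ N x -> psd (mx_density G1 lam x).
  by move=> Nx; apply: pN1 => N1x; apply: Nx; right.
pose mOmega := smooth_domain_measurable hOmega.
pose S0 := root_density lam G0 N; pose S1 := root_density lam G1 N.
have sS0 : forall x, symmx (S0 x) by exact: root_density_sym.
have sS1 : forall x, symmx (S1 x) by exact: root_density_sym.
have mS0 : mx_measurable S0 by exact: root_density_measurable.
have mS1 : mx_measurable S1 by exact: root_density_measurable.
have iS0 : mx_integrable lam (fun x => S0 x *m S0 x) by exact: root_density_integrable.
have iS1 : mx_integrable lam (fun x => S1 x *m S1 x) by exact: root_density_integrable.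
pose mu := path_measure k mOmega sS0 sS1 mS0 mS1 iS0 iS1.
have muCE : CE D0 D Omega G0 G1 mu.
  have G0E i j A := root_density_integral hG0lam mN lamN pN0 i j (A := A).
  have G1E i j A := root_density_integral hG1lam mN lamN pN1 i j (A := A).
  exact: (path_measure_CE hOmega sS0 sS1 mS0 mS1 iS0 iS1 G0E G1E D0 D).
have act0 L : (0 <= action L L2 (cylinder Omega) mu)%E.
  by apply: integral_ge0 => z _; exact: Jfun_ge0.
have actle L := path_action_le mOmega sS0 sS1 mS0 mS1 iS0 iS1 (L : 'M[R]_k) L2.
have iD : mx_integrable lam (fun x => sqrt_diff S0 S1 x *m sqrt_diff S0 S1 x).
  exact: sqrt_diff_integrable.
have ifrob : lam.-integrable setT (fun x => (frob (sqrt_diff S0 S1 x) ^+ 2)%:E).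
  have : lam.-integrable setT (fun x => \sum_(i < n)
      ((sqrt_diff S0 S1 x *m sqrt_diff S0 S1 x) i i)%:E)%E.
    by apply: integrable_sum => // i _; exact: iD.
  apply: eq_integrable => // x _; rewrite sumEFin frob_sqr /mxdot; congr EFin.
  by rewrite /sqrt_diff [(S1 x - S0 x)^T]linearB/= sS0 sS1.
have ifrobO := integrableS measurableT mOmega (@subsetT _ _) ifrob.
split; last (split; first exact: WB2_le0).
  exists mu; split=> //.
  rewrite ge0_fin_numE//; apply: (le_lt_trans (actle L1)).
  under eq_integral do rewrite EFinM.
  by rewrite integralZl// ltey_eq fin_numM// integrable_fin_num.
apply: (@le_trans _ _ (action 0 L2 (cylinder Omega) mu)).
  by apply: ereal_inf_lbound; exists mu.
apply: (le_trans (actle 0)).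
under eq_integral do rewrite EFinM.
rewrite integralZl//; apply: lee_wpmul2l.
  by rewrite lee_fin mulr_ge0// sqr_ge0.
apply: ge0_le_integral_nonmeasurable => x Ox; rewrite lee_fin ?sqr_ge0//.
rewrite /sqrt_diff /S0 /S1 /root_density.
(* Off [N] the roots are those of the densities themselves; on [N] both modified roots are equal, so
   the left-hand side is 0. *)
have [Nx|Nx] := pselect (N x); last by rewrite !psd_part_out.
by rewrite !psd_part_in// subrr /frob /mxdot mulmx0 mxtrace0 sqrtr0 expr0n sqr_ge0.
Qed.
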